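(* On the affine piece $\{a_0\neq 0\}$, the open swallowtail $\mathcal{S}_n$ is minimally generated (as an $\mathcal{O}_\Delta$-module) by $n-2$ elements. In particular, it is not isomorphic to the normalization of $\Delta_n$ (that is, to $\pi_*\mathcal{O}_{\bar\Delta}$ as a module) and, when $n>3$, it is not free.
   Context: $\mathbb{K}$ is an algebraically closed field of characteristic zero. $\mathbb{P}(V)\cong\mathbb{P}^n$ has homogeneous coordinates $a_0,\dots,a_n$, and its points are identified with nonzero binary forms $f=a_0x^n+a_1x^{n-1}y+\cdots+a_ny^n$ of degree $n$ up to scalar; $\mathbb{P}(W)\cong\mathbb{P}^1$ has homogeneous coordinates $x,y$. $\mathbf{P}:=\mathbb{P}(V)\times\mathbb{P}(W)$ and $F=\sum_{i=0}^n a_ix^{n-i}y^i$ is the universal form. $\Delta=\Delta_n\subset\mathbb{P}(V)$ is the classical discriminant: the hypersurface of forms having a root of multiplicity at least $2$. $\bar\Delta\subset\mathbf{P}$ is the variety defined by $F_x=F_y=0$, and $\pi:\bar\Delta\to\Delta$ is the projection $(f,t)\mapsto f$, which is the normalization of $\Delta$. The (algebraic) open swallowtail $\mathcal{S}_n$ is the kernel of the universal derivation $d:\pi_*\mathcal{O}_{\bar\Delta}\to\pi_*\Omega^1_{\bar\Delta/\Delta}$, where $\Omega^1_{\bar\Delta/\Delta}$ is the sheaf of relative differentials; it is an $\mathcal{O}_\Delta$-subalgebra of $\pi_*\mathcal{O}_{\bar\Delta}$.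
   Formalization: The formal statement assumes n ≥ 3; for n = 2 the claim fails, since the projection to the discriminant is an isomorphism on {a_0 ≠ 0}, so the swallowtail equals O_Δ, needs one generator instead of n−2 = 0, and is isomorphic to the normalization. *)

(* Defs.v *)
From HB Require Import structures.
From mathcomp Require Import all_boot all_algebra.
From mathcomp Require Import boolp.
From mathcomp Require Import mpoly.
From mathcomp Require monalg.
From mathcomp Require Import ring.

Set Implicit Arguments.
Unset Strict Implicit.
Unset Printing Implicit Defensive.

Import GRing.Theory Quotient.
Local Open Scope ring_scope.
Local Open Scope quotient_scope.

Section ModuleNotions.
Import monalg.
Variable R : comNzRingType.

Definition generates (M : lmodType R) (k : nat) (g : 'I_k -> M) : Prop :=
  forall m : M, exists c : 'I_k -> R, m = \sum_(i < k) c i *: g i.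

(* The least number of generators of M is k. *)
Definition minimally_generated_by (M : lmodType R) (k : nat) : Prop :=
  (exists g : 'I_k -> M, generates g) /\
  (forall (l : nat) (g : 'I_l -> M), generates g -> (k <= l)%N).

Definition module_iso (M N : lmodType R) : Prop :=
  exists f : {linear M -> N}, bijective f.

(* {malg R[I]} is the direct sum of copies of R indexed by I. *)
Definition free_module (M : lmodType R) : Prop :=
  exists I : choiceType, module_iso ({malg R[I]} : lmodType R) M.

End ModuleNotions.

(* B as an A-algebra through the ring morphism f. *)
Section AlgebraAlong.
Variables (A B : comNzRingType) (f : {rmorphism A -> B}).

Definition alg_along : Type := let _ := f in B.

HB.instance Definition _ := GRing.ComNzRing.copy alg_along B.

Definition along_scale (a : A) (b : alg_along) : alg_along := f a * (b : B).

Fact along_scaleA a b c :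
  along_scale a (along_scale b c) = along_scale (a * b) c.
Proof. by rewrite /along_scale rmorphM mulrA. Qed.
Fact along_scale0 b : along_scale 0 b = 0.
Proof. by rewrite /along_scale rmorph0 mul0r. Qed.
Fact along_scale1 : left_id 1 along_scale.
Proof. by move=> b; rewrite /along_scale rmorph1 mul1r. Qed.
Fact along_scaleDr : right_distributive along_scale +%R.
Proof. by move=> a b c; rewrite /along_scale mulrDr. Qed.
Fact along_scaleDl b : {morph along_scale^~ b : a c / a + c}.
Proof. by move=> a c; rewrite /along_scale rmorphD mulrDl. Qed.

HB.instance Definition _ := GRing.Nmodule_isLSemiModule.Build A alg_along
  along_scaleA along_scale0 along_scale1 along_scaleDr along_scaleDl.

Fact along_scaleAl a (b c : alg_along) : a *: (b * c) = a *: b * c.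
Proof. exact: mulrA. Qed.

HB.instance Definition _ :=
  GRing.Lmodule_isLalgebra.Build A alg_along along_scaleAl.
HB.instance Definition _ := GRing.Lalgebra_isComAlgebra.Build A alg_along.

Lemma along_scaleE (a : A) (b : alg_along) : a *: b = f a * (b : B).
Proof. by []. Qed.

End AlgebraAlong.

(* The module of relative differentials of the A-algebra B: the free B-module
   on the symbols << b >>, b in B, modulo the submodule generated by the
   relations making b |-> << b >> an A-derivation. *)
Section Kaehler.
Import monalg.
Variables (A : comNzRingType) (B : comAlgType A).

Local Notation dsym b := (mkmalgU (b : B) (1 : B)).

Inductive kaehler_relation : {malg B[B]} -> Prop :=
| KaehlerZero : kaehler_relation 0
| KaehlerComb (b : B) (u v : {malg B[B]}) : kaehler_relation u ->
    kaehler_relation v -> kaehler_relation (b *: u + v)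
| KaehlerAdd (b c : B) : kaehler_relation (dsym (b + c) - (dsym b + dsym c))
| KaehlerLeibniz (b c : B) :
    kaehler_relation (dsym (b * c) - (b *: dsym c + c *: dsym b))
| KaehlerConst (a : A) : kaehler_relation (dsym (a%:A)).

Definition kaehler_relations : {pred {malg B[B]}} :=
  fun u => `[< kaehler_relation u >].

Lemma kaehler_submod_closed : submod_closed kaehler_relations.
Proof.
split; first exact/asboolP/KaehlerZero.
by move=> b u v /asboolP hu /asboolP hv; apply/asboolP/KaehlerComb.
Qed.

HB.instance Definition _ := GRing.isSubmodClosed.Build B {malg B[B]}
  kaehler_relations kaehler_submod_closed.

Local Notation Omega := {quot kaehler_relations}.

Lemma pi_Omega_eq (u v : {malg B[B]}) :
  u - v \in kaehler_relations -> \pi_Omega u = \pi_Omega v.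
Proof. by move=> uv; apply/eqP; rewrite -idealrBE; exact: uv. Qed.

Definition Omega_scale (a : B) (w : Omega) : Omega := \pi_Omega (a *: repr w).

Lemma Omega_scale_pi a u : Omega_scale a (\pi_Omega u) = \pi_Omega (a *: u).
Proof.
by apply/pi_Omega_eq; rewrite -scalerBr rpredZ // idealrBE reprK.
Qed.

Fact Omega_scaleA a b w :
  Omega_scale a (Omega_scale b w) = Omega_scale (a * b) w.
Proof.
by elim/quotW: w => u; rewrite (Omega_scale_pi b) !Omega_scale_pi scalerA.
Qed.

Fact Omega_scale1 : left_id 1 Omega_scale.
Proof. by move=> w; elim/quotW: w => u; rewrite Omega_scale_pi scale1r. Qed.

Fact Omega_scaleDr : right_distributive Omega_scale +%R.
Proof.
move=> b v w; elim/quotW: v => v; elim/quotW: w => w.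
by rewrite !Omega_scale_pi -!raddfD /= Omega_scale_pi scalerDr.
Qed.

Fact Omega_scaleDl w : {morph Omega_scale^~ w : a b / a + b}.
Proof.
move=> a b; elim/quotW: w => w.
by rewrite !Omega_scale_pi -raddfD /= scalerDl.
Qed.

HB.instance Definition _ := GRing.Zmodule_isLmodule.Build B Omega
  Omega_scaleA Omega_scale1 Omega_scaleDr Omega_scaleDl.

Fact pi_Omega_scalable : scalable (\pi_Omega : {malg B[B]} -> Omega).
Proof. by move=> a u; rewrite -Omega_scale_pi. Qed.

Definition univ_der (b : B) : Omega := \pi_Omega (dsym b).

Lemma univ_derD b c : univ_der (b + c) = univ_der b + univ_der c.
Proof.
rewrite /univ_der -[RHS]raddfD; apply: pi_Omega_eq.
exact/asboolP/KaehlerAdd.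
Qed.

Lemma univ_derM b c : univ_der (b * c) = b *: univ_der c + c *: univ_der b.
Proof.
rewrite /univ_der -!pi_Omega_scalable -[RHS]raddfD; apply: pi_Omega_eq.
exact/asboolP/KaehlerLeibniz.
Qed.

Lemma univ_der_const (a : A) : univ_der a%:A = 0.
Proof.
rewrite /univ_der -[RHS](raddf0 \pi_Omega).
by apply: pi_Omega_eq; rewrite subr0; apply/asboolP/KaehlerConst.
Qed.

Definition univ_der_ker : {pred B} := fun b => univ_der b == 0.

Lemma univ_der_ker_submod_closed : submod_closed univ_der_ker.
Proof.
split; first by rewrite unfold_in -(scale0r (1 : B)) univ_der_const.
move=> a b c; rewrite !unfold_in => /eqP hb /eqP hc; apply/eqP.
by rewrite univ_derD hc addr0 -mulr_algl univ_derM hb univ_der_const !scaler0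
  addr0.
Qed.

HB.instance Definition _ := GRing.isSubmodClosed.Build A B
  univ_der_ker univ_der_ker_submod_closed.

Record kernel_of_d := KernelOfD {
  kernel_val :> B;
  _ : kernel_val \in univ_der_ker }.

HB.instance Definition _ := [isSub for kernel_val].
HB.instance Definition _ := [Choice of kernel_of_d by <:].
HB.instance Definition _ := [SubChoice_isSubLmodule of kernel_of_d by <:].

End Kaehler.

(* Coordinate rings of nonempty subsets of affine space. *)
Section CoordinateRing.
Variables (K : fieldType) (m : nat).

Record pointset := PointSet {
  points :> ('I_m -> K) -> Prop;
  points_nonempty : exists v, points v }.

Variable X : pointset.

Definition vanishing_ideal : {pred {mpoly K[m]}} :=
  fun p => `[< forall v, X v -> p.@[v] = 0 >].

Lemma vanishing_idealr_closed : idealr_closed vanishing_ideal.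
Proof.
split.
- by apply/asboolP => v _; rewrite meval0.
- apply/negP => /asboolP h; case: (points_nonempty X) => v /h /eqP.
  by rewrite meval1 oner_eq0.
- move=> a p q /asboolP hp /asboolP hq; apply/asboolP => v Xv.
  by rewrite mevalD mevalM (hp v Xv) (hq v Xv) mulr0 addr0.
Qed.

HB.instance Definition _ := isIdealr.Build {mpoly K[m]} vanishing_ideal
  vanishing_idealr_closed.

Definition coord_ring : comNzRingType := {ideal_quot vanishing_ideal}.

Definition reg (p : {mpoly K[m]}) : coord_ring :=
  \pi_({ideal_quot vanishing_ideal}) p.

Lemma reg_eqP p q : reg p = reg q <-> (forall v, X v -> p.@[v] = q.@[v]).
Proof.
split=> [/eqP|h].
  rewrite /reg -idealrBE => /asboolP h v /h /eqP.
  by rewrite mevalB subr_eq0 => /eqP.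
apply/eqP; rewrite /reg -idealrBE; apply/asboolP => v Xv.
by rewrite mevalB h // subrr.
Qed.

End CoordinateRing.

Section BinaryForms.
Variables (K : fieldType) (n : nat).

Local Notation X := ('X_ord0 : {mpoly K[2]}).
Local Notation Y := ('X_ord_max : {mpoly K[2]}).

(* a_0 x^n + a_1 x^(n-1) y + ... + a_n y^n *)
Definition bform (a : 'I_n.+1 -> K) : {mpoly K[2]} :=
  \sum_(i < n.+1) a i *: (X ^+ (n - i) * Y ^+ i).

Definition pt (x y : K) : 'I_2 -> K := fun i => if i == ord0 then x else y.

Definition multiple_root (f : {mpoly K[2]}) (x y : K) : Prop :=
  exists g : {mpoly K[2]}, f = (y *: X - x *: Y) ^+ 2 * g.

(* The cone over the discriminant hypersurface in P(V). *)
Definition Delta (a : 'I_n.+1 -> K) : Prop :=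
  (exists i, a i != 0) /\
  (exists x y, ((x != 0) || (y != 0)) /\ multiple_root (bform a) x y).

(* Homogeneous coordinates (a, (x : y)) of the points of the variety
   F_x = F_y = 0 in P(V) x P(W). *)
Definition barDelta (a : 'I_n.+1 -> K) (x y : K) : Prop :=
  [/\ exists i, a i != 0, (x != 0) || (y != 0),
      (bform a)^`M(ord0).@[pt x y] = 0
    & (bform a)^`M(ord_max).@[pt x y] = 0].

(* The chart a_0 = 1 of P(V): coordinate i of K^n is a_(i+1). *)
Definition chart (a : 'I_n -> K) : 'I_n.+1 -> K :=
  fun i => if unlift ord0 i is Some j then a j else 1.

End BinaryForms.

Section BinaryFormsTheory.
Variables (K : fieldType) (n : nat).
Hypothesis charK : [pchar K] =i pred0.

Local Notation X := ('X_ord0 : {mpoly K[2]}).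
Local Notation Y := ('X_ord_max : {mpoly K[2]}).

Lemma mderiv_var (i j : 'I_2) : ('X_j : {mpoly K[2]})^`M(i) = (j == i)%:R.
Proof.
rewrite mderivX mnm1E; case: eqP => [->|_]; last by rewrite scale0r.
have -> : (U_(i) - U_(i) = 0 :> 'X_{1..2})%MM.
  by apply/mnmP => k; rewrite mnmBE mnm0E subnn.
by rewrite scale1r mpolyX0.
Qed.

Lemma mderivXn (i : 'I_2) (p : {mpoly K[2]}) k :
  (p ^+ k)^`M(i) = (p^`M(i) * p ^+ k.-1) *+ k.
Proof.
elim: k => [|k IH]; first by rewrite expr0 mulr0n -mpolyC1 mderivC.
rewrite exprS mderivM IH mulrnAr mulrCA -exprS /= mulrS.
by case: k {IH} => [|k] //=; rewrite !mulr0n.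
Qed.

Lemma bform_eval (a : 'I_n.+1 -> K) x y :
  (bform a).@[pt x y] = \sum_(i < n.+1) a i * (x ^+ (n - i) * y ^+ i).
Proof.
rewrite /bform (raddf_sum (meval _)); apply: eq_bigr => i _ /=.
by rewrite mevalZ mevalM !rmorphXn /= !mevalXU.
Qed.

Lemma bform_dx (a : 'I_n.+1 -> K) x y :
  (bform a)^`M(ord0).@[pt x y] =
  \sum_(i < n.+1) a i * ((x ^+ (n - i).-1 *+ (n - i)) * y ^+ i).
Proof.
rewrite /bform (linear_sum (mderiv _)) (raddf_sum (meval _)).
apply: eq_bigr => i _ /=.
rewrite mderivZ mevalZ mderivM !mderivXn !mderiv_var /= mul0r.
rewrite mul0rn mulr0 addr0 mul1r.
by rewrite mevalM raddfMn /= !rmorphXn /= !mevalXU.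
Qed.

Lemma bform_dy (a : 'I_n.+1 -> K) x y :
  (bform a)^`M(ord_max).@[pt x y] =
  \sum_(i < n.+1) a i * (x ^+ (n - i) * (y ^+ i.-1 *+ i)).
Proof.
rewrite /bform (linear_sum (mderiv _)) (raddf_sum (meval _)).
apply: eq_bigr => i _ /=.
rewrite mderivZ mevalZ mderivM !mderivXn !mderiv_var /= mul0r.
rewrite mul0rn mul0r add0r mul1r.
by rewrite mevalM raddfMn /= !rmorphXn /= !mevalXU.
Qed.

Lemma bform_euler (a : 'I_n.+1 -> K) x y :
  (bform a).@[pt x y] *+ n =
  x * (bform a)^`M(ord0).@[pt x y] + y * (bform a)^`M(ord_max).@[pt x y].
Proof.
rewrite bform_eval bform_dx bform_dy !mulr_sumr -big_split -sumrMnl /=.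
apply: eq_bigr => i _; have le_in : (i <= n)%N by rewrite -ltnS.
have E (z : K) k : z * (z ^+ k.-1 *+ k) = z ^+ k *+ k.
  by case: k => [|k]; rewrite ?mulr0n ?mulr0 // mulrnAr -exprS.
rewrite (mulrCA x) (mulrA x) E (mulrCA y) (mulrCA y) E -mulrDr.
by rewrite mulrnAl mulrnAr -mulrnDr subnK // mulrnAr.
Qed.

Hypothesis n_gt0 : (0 < n)%N.

Lemma bform_eq0 (a : 'I_n.+1 -> K) x y :
    (bform a)^`M(ord0).@[pt x y] = 0 -> (bform a)^`M(ord_max).@[pt x y] = 0 ->
  (bform a).@[pt x y] = 0.
Proof.
move=> hx hy; have := bform_euler a x y; rewrite hx hy !mulr0 addr0 => /eqP.
rewrite -mulr_natr mulf_eq0 ((pcharf0P K).1 charK) (gtn_eqF n_gt0) orbF.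
by move/eqP.
Qed.

(* The point of P(W) lies in the chart y = 1 over the chart a_0 = 1. *)
Lemma barDelta_chart (a : 'I_n -> K) x y : barDelta (chart a) x y -> y != 0.
Proof.
case=> _ xy hx hy; apply: contraTneq xy => y0; rewrite y0 eqxx orbF negbK.
have := bform_eq0 hx hy; rewrite bform_eval y0 big_ord_recl big1 => [|i _].
  rewrite /chart unlift_none mul1r subn0 expr0 mulr1 addr0 => /eqP.
  by rewrite expf_eq0 n_gt0.
by rewrite expr0n mulr0 mulr0.
Qed.

Let pow_expand (R : comNzRingType) (x t y : R) k : exists g : R, x ^+ k =
  t ^+ k * y ^+ k + (t ^+ k.-1 *+ k) * ((x - t * y) * y ^+ k.-1)
  + (x - t * y) ^+ 2 * g.
Proof.
elim: k => [|k [g IH]].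
  by exists 0; rewrite !expr0 mulr0n mul0r mulr0 !addr0 mulr1.
exists (x * g + (t ^+ k.-1 *+ k) * y ^+ k.-1).
rewrite exprS IH; case: k {IH} => [|k] /=.
  by rewrite !expr0 !mulr0n; ring.
rewrite !exprS (mulrS _ k.+1) -(mulr_natr _ k.+1).
by set N := _%:R; set tk := t ^+ k; ring.
Qed.

(* pi maps barDelta to Delta. *)
Lemma barDelta_Delta (a : 'I_n.+1 -> K) t : barDelta a t 1 -> Delta a.
Proof.
case=> a0 _ hx hy; split=> //; exists t, 1; rewrite oner_eq0 orbT; split=> //.
have f0 := bform_eq0 hx hy; rewrite /multiple_root scale1r.
pose g k := sval (cid (pow_expand X t%:MP Y k)).
have gP k : X ^+ k = _ := svalP (cid (pow_expand X t%:MP Y k)).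
exists (\sum_(i < n.+1) a i *: (g (n - i)%N * Y ^+ i)).
transitivity ((bform a).@[pt t 1] *: Y ^+ n
  + (bform a)^`M(ord0).@[pt t 1] *: ((X - t *: Y) * Y ^+ n.-1)
  + (X - t *: Y) ^+ 2 * (\sum_(i < n.+1) a i *: (g (n - i)%N * Y ^+ i)));
  last first.
  by rewrite f0 hx !scale0r !add0r.
rewrite bform_eval bform_dx !scaler_suml mulr_sumr -!big_split /=.
apply: eq_bigr => i _; have le_in : (i <= n)%N by rewrite -ltnS.
have Yn : Y ^+ n = Y ^+ (n - i) * Y ^+ i by rewrite -exprD subnK.
have Yn1 : (t%:MP ^+ (n - i).-1 *+ (n - i)) * Y ^+ n.-1
    = (t%:MP ^+ (n - i).-1 *+ (n - i)) * (Y ^+ (n - i).-1 * Y ^+ i).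
  case E : (n - i)%N => [|k]; first by rewrite !mulr0n !mul0r.
  by rewrite -exprD -[(k + i)%N]/(k.+1 + i).-1 -E subnK.
rewrite gP -/(g _) !expr1n !mulr1 -!mul_mpolyC Yn !mpolyCM !mpolyCMn.
rewrite !(rmorphXn (@mpolyC 2 K)) /=.
move: (t%:MP ^+ (n - i).-1 *+ (n - i)) Yn1 => u Yn1.
have -> : (a i)%:MP * u * ((X - t%:MP * Y) * Y ^+ n.-1)
    = (a i)%:MP * (X - t%:MP * Y) * (u * Y ^+ n.-1).
  by rewrite -!mulrA [u * _]mulrCA.
rewrite Yn1.
move: (X - _) (a i)%:MP (g _) (Y ^+ (n - i)) (Y ^+ i) (Y ^+ (n - i).-1).
move: (t%:MP ^+ _).
by move=> w d b h y1 y2 y3; ring.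
Qed.

End BinaryFormsTheory.

Section Swallowtail.
Variables (K : closedFieldType) (charK : [pchar K] =i pred0).
Variables (n : nat) (n_gt1 : (1 < n)%N).

Let n_gt0 : (0 < n)%N := ltnW n_gt1.

(* Over a_0 = 1 all points of barDelta satisfy y != 0 (barDelta_chart), so they
   are the points v of K^(n+1) with v_0 = t and v_i = a_i for i > 0, standing
   for the form with coefficients 1, a_1, ..., a_n and its root (t : 1). *)
Definition root_coord (v : 'I_n.+1 -> K) : K := v ord0.
Definition form_coords (v : 'I_n.+1 -> K) : 'I_n -> K :=
  fun i => v (lift ord0 i).

Definition barDelta_aff_pts (v : 'I_n.+1 -> K) : Prop :=
  barDelta (chart (form_coords v)) (root_coord v) 1.

Definition Delta_aff_pts (a : 'I_n -> K) : Prop := Delta (chart a).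

Lemma chart_neq0 (a : 'I_n -> K) : exists i, chart a i != 0.
Proof. by exists ord0; rewrite /chart unlift_none oner_eq0. Qed.

Lemma barDelta_aff_nonempty : exists v, barDelta_aff_pts v.
Proof.
have ch0 (i : 'I_n) : chart (form_coords (fun=> 0 : K)) (lift ord0 i) = 0.
  by rewrite /chart liftK.
exists (fun=> 0); split; first exact: chart_neq0.
- by rewrite oner_eq0 orbT.
- rewrite bform_dx big_ord_recl big1 => [|i _]; last by rewrite ch0 mul0r.
  rewrite /root_coord subn0 expr0n -subn1 subn_eq0 leqNgt n_gt1 /=.
  by rewrite mul0rn mul0r mulr0 addr0.
- rewrite bform_dy big_ord_recl big1 => [|i _]; last by rewrite ch0 mul0r.
  by rewrite mulr0n !mulr0 addr0.
Qed.

Lemma form_coords_Delta v : barDelta_aff_pts v -> Delta_aff_pts (form_coords v).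
Proof. exact: barDelta_Delta. Qed.

Lemma Delta_aff_nonempty : exists a, Delta_aff_pts a.
Proof.
case: barDelta_aff_nonempty => v /form_coords_Delta hv.
by exists (form_coords v).
Qed.

Definition Delta_aff : pointset K n := PointSet Delta_aff_nonempty.
Definition barDelta_aff : pointset K n.+1 := PointSet barDelta_aff_nonempty.

Definition O_Delta : comNzRingType := coord_ring Delta_aff.
Definition O_barDelta : comNzRingType := coord_ring barDelta_aff.

Definition form_coords_comp (p : {mpoly K[n]}) : {mpoly K[n.+1]} :=
  p \mPo [tuple 'X_(lift ord0 i) | i < n].

Lemma form_coords_compE p v :
  (form_coords_comp p).@[v] = p.@[form_coords v].
Proof.
rewrite comp_mpoly_meval; apply: meval_eq => i.
by rewrite tnth_mktuple mevalXU.
Qed.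

(* The comorphism of pi. *)
Definition pi_sharp (p : O_Delta) : O_barDelta :=
  reg barDelta_aff (form_coords_comp (repr (p : {ideal_quot _}))).

Lemma pi_sharp_reg (p : {mpoly K[n]}) :
  pi_sharp (reg Delta_aff p) = reg barDelta_aff (form_coords_comp p).
Proof.
apply/reg_eqP => v /form_coords_Delta hv; rewrite !form_coords_compE.
move: (form_coords v) hv; apply/(@reg_eqP _ _ Delta_aff).
exact: reprK.
Qed.

Fact pi_sharp_zmod_morphism : zmod_morphism pi_sharp.
Proof.
move=> p q; rewrite -[p]reprK -[q]reprK.
rewrite -[in LHS]raddfB /= -!/(reg Delta_aff _) !pi_sharp_reg.
by rewrite /form_coords_comp raddfB /reg raddfB.
Qed.

Fact pi_sharp_monoid_morphism : monoid_morphism pi_sharp.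
Proof.
split=> [|p q].
  have -> : (1 : O_Delta) = reg Delta_aff 1 by rewrite /reg rmorph1.
  by rewrite pi_sharp_reg /form_coords_comp rmorph1 /reg rmorph1.
rewrite -[p]reprK -[q]reprK.
rewrite -[in LHS]rmorphM /= -!/(reg Delta_aff _) !pi_sharp_reg.
by rewrite /form_coords_comp rmorphM /reg rmorphM.
Qed.

HB.instance Definition _ := GRing.isZmodMorphism.Build O_Delta O_barDelta
  pi_sharp pi_sharp_zmod_morphism.
HB.instance Definition _ := GRing.isMonoidMorphism.Build O_Delta O_barDelta
  pi_sharp pi_sharp_monoid_morphism.

(* The O_Delta-algebra pi_* O_barDelta over a_0 != 0. *)
Definition pi_O_barDelta : comAlgType O_Delta := alg_along pi_sharp.

(* The open swallowtail over a_0 != 0. *)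
Definition swallowtail : lmodType O_Delta := kernel_of_d pi_O_barDelta.

End Swallowtail.

(* Main.v *)
From HB Require Import structures.
Require Import Defs.
From mathcomp Require Import all_boot all_algebra.
From mathcomp Require Import boolp finmap mpoly zify ring.
From mathcomp Require monalg.

(** Write n = m + 2.  On the chart a_0 = 1 the equations F = F_x = 0 at the root
    t determine a_(n-1) and a_n from t and a_1, ..., a_m: if p is the part of
    F(x, 1) of degree at least 2 in x, then a_(n-1) = - p'(t) and
    a_n = t p'(t) - p(t).  Hence the coordinate ring of barDelta is E = C[t] with
    C = K[a_1, ..., a_m] ([barDelta_polyK], [barDelta_funK]), and O_Delta acts on
    it through the subring C[a_(n-1), a_n].

    The t-derivatives of a_(n-1) and a_n are -h and t h, where h = p'' has degree
    m and constant leading coefficient.  So the relative differentials are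
    E dt / (h dt), and b lies in the open swallowtail exactly when h divides
    b' ([univ_der_ker_swallow]).  The swallowtail is therefore the C-module freely
    generated by 1 and the primitives f_k of h t^k, k >= 0, where f_k has degree
    m + k + 1.  Here f_0 and f_1 are, up to sign and constants, a_(n-1) and a_n,
    and for k > m the product f_0 f_(k-m-1) has the degree of f_k with a constant
    leading coefficient.  Cancelling leading terms, the m elements 1, f_2, ..., f_m
    generate over O_Delta ([swallow_spanned]).

    For the lower bounds, set a_1 = ... = a_m = 0.  Then O_Delta becomes the
    cuspidal ring K[t^(m+1), t^(m+2)], and the swallowtail has no terms in
    t, ..., t^m.  Because of these gaps the coefficients of
    1, t^(m+3), ..., t^(2m+1) on the swallowtail, and of 1, t, ..., t^m on E, are
    semilinear over evaluation of O_Delta at the origin ([coef_form_substM_swallow],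
    [coef_form_substM_low]).  This yields at least m generators for the
    swallowtail and at least m + 1 = n - 1 for the normalization, so the two
    modules are not isomorphic.

    Suppose finally that the swallowtail is free.  An element that vanishes at
    a_1 = ... = a_m = 0 is a combination of the a_j with coefficients in the
    swallowtail ([swallow_restr_eq0]), so distinct basis elements e_1, e_2 would
    stay independent over the cuspidal ring after restriction.  But any two
    elements r_1, r_2 of K[t] are dependent over that ring, since t^N r_1 and
    t^N r_2 belong to it for large N ([on_cusp_conductor]).  So the basis has at
    most one element, and m generators being necessary forces m <= 1. *)

Set Implicit Arguments.
Unset Strict Implicit.
Unset Printing Implicit Defensive.

Import GRing.Theory Quotient.
Local Open Scope ring_scope.
Local Open Scope quotient_scope.

(** * Polynomials that vanish everywhere *)
Lemma mpoly_ring_ind (n : nat) (R : nzRingType) (P : {mpoly R[n]} -> Prop) :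
    (forall c, P c%:MP) -> (forall i, P 'X_i) ->
    (forall p q, P p -> P q -> P (p + q)) ->
    (forall p q, P p -> P q -> P (p * q)) ->
  forall p, P p.
Proof.
move=> PC PX PD PM; apply: mpolyind => [|c m p _ _ Pp]; first exact: PC.
apply/PD => //; rewrite -mul_mpolyC; apply/PM; first exact: PC.
rewrite mpolyXE_id; elim/big_rec: _ => [|i q _ Pq]; first exact: (PC 1).
apply/PM => //; elim: (m i) => [|k IH]; first exact: (PC 1).
by rewrite exprS; apply/PM.
Qed.

Lemma mpoly_rmorph_ext (n : nat) (R S : nzRingType)
    (f g : {rmorphism {mpoly R[n]} -> S}) :
    (forall c, f c%:MP = g c%:MP) -> (forall i, f 'X_i = g 'X_i) -> f =1 g.
Proof.
move=> fgC fgX; apply: mpoly_ring_ind => // p q fgp fgq.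
  by rewrite !rmorphD fgp fgq.
by rewrite !rmorphM fgp fgq.
Qed.

Section ZeroTest.
Variable K : fieldType.
Hypothesis charK : [pchar K] =i pred0.

Lemma natr_neq0 k : (0 < k)%N -> k%:R != 0 :> K.
Proof. by move=> k0; rewrite ((pcharf0P K).1 charK) -lt0n. Qed.

Lemma natr_inj : injective (fun k => k%:R : K).
Proof.
move=> i j; wlog le_ij : i j / (i <= j)%N => [hw|].
  by case: (leqP i j) => [|/ltnW] le e; [|apply/esym]; apply: hw.
move/esym/eqP; rewrite -subr_eq0 -natrB // ((pcharf0P K).1 charK) subn_eq0.
by move=> le_ji; apply/eqP; rewrite eqn_leq le_ij.
Qed.

Lemma poly_eval_eq0 (p : {poly K}) : (forall x, p.[x] = 0) -> p = 0.
Proof.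
move=> p0; apply/eqP; apply: contraT => pN0.
have := @max_poly_roots _ p [seq k%:R | k <- iota 0 (size p)] pN0.
rewrite size_map size_iota ltnn; apply.
  by apply/allP => x _; rewrite rootE p0.
by rewrite map_inj_uniq ?iota_uniq //; exact: natr_inj.
Qed.

(** The first variable becomes the univariate one, which allows induction on the
    number of variables. *)
Definition mpoly_uni (n : nat) : {mpoly K[n.+1]} -> {poly {mpoly K[n]}} :=
  mmap (polyC \o @mpolyC n K)
       (fun i => if unlift ord0 i is Some j then ('X_j)%:P else 'X).

HB.instance Definition _ n := GRing.RMorphism.on (@mpoly_uni n).

Lemma mpoly_uniC n c : mpoly_uni (c%:MP : {mpoly K[n.+1]}) = (c%:MP)%:P.
Proof. exact: mmapC. Qed.

Lemma mpoly_uniX n (i : 'I_n.+1) : mpoly_uni ('X_i : {mpoly K[n.+1]}) =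
  if unlift ord0 i is Some j then ('X_j)%:P else 'X.
Proof. by rewrite /mpoly_uni mmapX mmap1U. Qed.

Definition poly_ev n (t : K) (a : 'I_n -> K) : {poly {mpoly K[n]}} -> K :=
  horner_eval t \o map_poly (meval a).

HB.instance Definition _ n t a := GRing.RMorphism.on (@poly_ev n t a).

Lemma poly_evB n t (a : 'I_n -> K) : {morph poly_ev t a : p q / p - q}.
Proof. exact: raddfB. Qed.

Lemma poly_evM n t (a : 'I_n -> K) : {morph poly_ev t a : p q / p * q}.
Proof. exact: (rmorphM (poly_ev t a)). Qed.

Lemma poly_evN n t (a : 'I_n -> K) : {morph poly_ev t a : p / - p}.
Proof. exact: raddfN. Qed.

Lemma poly_evC n t a (c : {mpoly K[n]}) : poly_ev t a c%:P = c.@[a].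
Proof. by rewrite /poly_ev /= map_polyC /horner_eval hornerC. Qed.

Lemma poly_evX n t (a : 'I_n -> K) : poly_ev t a 'X = t.
Proof. by rewrite /poly_ev /= map_polyX /horner_eval hornerX. Qed.

Lemma mpoly_uni_ev n (p : {mpoly K[n.+1]}) t a : poly_ev t a (mpoly_uni p) =
  p.@[fun i => if unlift ord0 i is Some j then a j else t].
Proof.
pose f : {rmorphism _ -> K} := poly_ev t a \o @mpoly_uni n.
apply: (@mpoly_rmorph_ext _ _ _ f (meval _)) => [c|i]; rewrite /f /=.
  by rewrite mpoly_uniC poly_evC !mevalC.
rewrite mpoly_uniX mevalXU; case: unliftP => [j _|_].
  by rewrite poly_evC mevalXU.
by rewrite poly_evX.
Qed.

Lemma mpoly_uni_inj n : injective (@mpoly_uni n).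
Proof.
pose w : {rmorphism {mpoly K[n]} -> {mpoly K[n.+1]}} :=
  mmap (@mpolyC n.+1 K) (fun j => 'X_(lift ord0 j)).
pose g : {rmorphism {poly {mpoly K[n]}} -> {mpoly K[n.+1]}} :=
  horner_eval 'X_ord0 \o map_poly w.
pose f : {rmorphism {mpoly K[n.+1]} -> {mpoly K[n.+1]}} := g \o @mpoly_uni n.
suff fK : f =1 idfun by move=> p q e; rewrite -[p]fK -[q]fK /f /= e.
apply: mpoly_rmorph_ext => [c|i]; rewrite /f /g /= /horner_eval.
  by rewrite mpoly_uniC map_polyC hornerC /= /w /= mmapC.
rewrite mpoly_uniX; case: unliftP => [j ->|->].
  by rewrite map_polyC hornerC /= /w /= mmapX mmap1U.
by rewrite map_polyX hornerX.
Qed.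

(** The zero test for C is a hypothesis because this lemma is also the inductive
    step in the proof of that test. *)
Lemma poly_ev_eq0 n (e : {poly {mpoly K[n]}}) :
    (forall c : {mpoly K[n]}, (forall a, c.@[a] = 0) -> c = 0) ->
  (forall t a, poly_ev t a e = 0) -> e = 0.
Proof.
move=> zeroC e0; apply/polyP => k; rewrite coef0; apply: zeroC => a.
have : map_poly (meval a) e = 0 by apply: poly_eval_eq0 => t; exact: e0.
by move/(congr1 (coefp k)); rewrite /= coef_map coef0.
Qed.

Lemma mpoly_eval_eq0 n (c : {mpoly K[n]}) : (forall a, c.@[a] = 0) -> c = 0.
Proof.
elim: n => [|n IH] in c *.
  by rewrite [c]nvar0_mpolyC => /(_ (fun=> 0)); rewrite mevalC => ->.
move=> c0; apply: mpoly_uni_inj; rewrite [RHS]rmorph0.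
apply: poly_ev_eq0 => // t a; rewrite mpoly_uni_ev; exact: c0.
Qed.

End ZeroTest.

(** * Universal derivations *)

(** A derivation D over theta that sends A into an ideal J respects, modulo J,
    each defining relation of the differentials; this is the universal property
    of the differentials for the target E / J, phrased with elements so that the
    quotient need not be formed. *)
Section KaehlerDerivation.
Import monalg.
Variables (A : comNzRingType) (B : comAlgType A) (E : comNzRingType).
Variables (theta : {rmorphism B -> E}) (D : B -> E) (J : E -> Prop).
Hypotheses (DD : {morph D : b c / b + c}).
Hypotheses (DM : forall b c, D (b * c) = theta b * D c + theta c * D b).
Hypotheses (J0 : J 0) (JD : forall x y, J x -> J y -> J (x + y)).
Hypotheses (JM : forall x y, J y -> J (x * y)).
Hypotheses (JA : forall a : A, J (D (a%:A))).

Let ev (u : {malg B[B]}) : E :=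
  \sum_(b <- msupp u) theta (mcoeff b u) * D b.

Let ev_w (u : {malg B[B]}) (d : {fset B}) : (msupp u `<=` d)%fset ->
  ev u = \sum_(b <- d) theta (mcoeff b u) * D b.
Proof.
move=> ud; rewrite /ev; apply: big_fset_incl => // b _ bu.
by rewrite mcoeff_outdom // rmorph0 mul0r.
Qed.

Let evD u v : ev (u + v) = ev u + ev v.
Proof.
pose d := (msupp u `|` msupp v)%fset.
rewrite (@ev_w (u + v) d) ?msuppD_le // (@ev_w u d) ?fsubsetUl //.
rewrite (@ev_w v d) ?fsubsetUr // -big_split; apply: eq_bigr => b _.
by rewrite mcoeffD rmorphD mulrDl.
Qed.

Let evZ x u : ev (x *: u) = theta x * ev u.
Proof.
rewrite (@ev_w (x *: u) (msupp u)) ?msuppZ_le // /ev mulr_sumr.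
by apply: eq_bigr => b _; rewrite mcoeffZ rmorphM mulrA.
Qed.

Let evU b : ev (mkmalgU b 1) = D b.
Proof.
rewrite (@ev_w _ [fset b]%fset) ?msuppU_le // big_seq_fset1.
by rewrite mcoeffUU rmorph1 mul1r.
Qed.

Let evN u : ev (- u) = - ev u.
Proof. by rewrite -scaleN1r evZ rmorphN1 mulN1r. Qed.

Lemma univ_der_eq0_derivation b : univ_der b = 0 -> J (D b).
Proof.
rewrite /univ_der -[RHS](raddf0 \pi_({quot _})) => /eqP.
rewrite -idealrBE subr0 => /asboolP rel; rewrite -evU.
elim: rel => [|x u v _ Ju _ Jv|x y|x y|a].
- by rewrite /ev msupp0 big_seq_fset0.
- by rewrite evD evZ; apply/JD => //; apply: JM.
- by rewrite !evD evN evD !evU DD subrr.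
- by rewrite evD evN evD !evZ !evU DM subrr.
- by rewrite evU.
Qed.

End KaehlerDerivation.

(** The chain rule: only the variable contributes a differential once the
    coefficients are killed by d. *)
Lemma univ_der_poly (A : comNzRingType) (B : comAlgType A) (C : nzRingType)
    (f : {rmorphism {poly C} -> B}) (p : {poly C}) :
    (forall c, univ_der (f c%:P) = 0) ->
  univ_der (f p) = f p^`() *: univ_der (f 'X).
Proof.
move=> fC; elim/poly_ind: p => [|p c IH].
  by rewrite derivC rmorph0 scale0r -(rmorph0 f) -polyC0 fC.
rewrite derivD derivM derivC derivX addr0 mulr1 !rmorphD !rmorphM univ_derD fC.
by rewrite univ_derM IH addr0 scalerDl scalerA addrC mulrC.
Qed.

(** * Counting generators *)

(** Such a lam factors through the residue module of M at the point chi, whose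
    dimension bounds the number of generators from below. *)
Lemma generators_lower_bound (A : comNzRingType) (K : fieldType)
    (M : lmodType A) (r : nat) (chi : A -> K) (lam : M -> 'rV[K]_r) :
    {morph lam : s t / s + t} ->
    (forall a s, lam (a *: s) = chi a *: lam s) ->
    (forall i, exists s, lam s = delta_mx 0 i) ->
  forall (l : nat) (g : 'I_l -> M), generates g -> (r <= l)%N.
Proof.
move=> lamD lamZ lam_onto l g gen.
have lam0 : lam 0 = 0 by apply: (addrI (lam 0)); rewrite -lamD !addr0.
pose G := \matrix_(j < l) lam (g j).
suff /mxrankS : ((1%:M : 'M[K]_r) <= G)%MS.
  by rewrite mxrank1 => /leq_trans; apply; apply: rank_leq_row.
apply/row_subP => i; rewrite row1; have [s <-] := lam_onto i.
have [c ->] := gen s; rewrite (big_morph _ lamD lam0).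
apply: summx_sub => j _; rewrite lamZ; apply: scalemx_sub.
by rewrite -(rowK (fun j => lam (g j))); apply: row_sub.
Qed.

(** * Primitives of polynomials *)
Section Antiderivative.
Variables (K : fieldType) (charK : [pchar K] =i pred0) (C : lalgType K).
Implicit Types (p : {poly C}).

(** The coefficient in degree 0 vanishes since 0^-1 = 0. *)
Definition antideriv p : {poly C} :=
  \poly_(i < (size p).+1) ((i%:R^-1 : K) *: p`_i.-1).

Lemma coef_antideriv p i : (antideriv p)`_i = (i%:R^-1 : K) *: p`_i.-1.
Proof.
rewrite coef_poly; case: ltnP => // lt_i.
by rewrite nth_default ?scaler0 // -ltnS prednK // (leq_trans _ lt_i).
Qed.

Lemma antiderivK : cancel antideriv (@deriv C).
Proof.
move=> p; apply/polyP => i; rewrite coef_deriv coef_antideriv /=.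
by rewrite -scaler_nat scalerA divff ?natr_neq0 // scale1r.
Qed.

Lemma deriv_eq0 p : p^`() = 0 -> p = (p`_0)%:P.
Proof.
move=> p'0; apply/polyP => -[|i]; rewrite coefC //=.
have /eqP := congr1 (coefp i) p'0; rewrite /= coef_deriv coef0 -scaler_nat.
rewrite scaler_eq0 (negPf (natr_neq0 charK _)) //.
by move/eqP.
Qed.

End Antiderivative.

(** * The forms over the discriminant in terms of a root *)
Section Normalization.
Variables (K : fieldType) (charK : [pchar K] =i pred0) (m : nat).
Local Notation C := {mpoly K[m]}.
Local Notation E := {poly C}.

(** The terms of F(x, 1) of degree at least 2 in x, for a_0 = 1 and n = m + 2; the
    variable of index j stands for a_(j+1). *)
Definition form_head : E :=
  'X^(m.+2) + \sum_(j < m) ('X_j)%:P * 'X^(m.+1 - j).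

(** The value of a_(i+1) on barDelta, as a function of t and a_1, ..., a_m. *)
Definition form_coef (i : 'I_m.+2) : E :=
  if insub (val i) is Some j then ('X_(j : 'I_m))%:P
  else if i == m :> nat then - form_head^`()
  else 'X * form_head^`() - form_head.

Lemma form_coef_widen (j : 'I_m) (i : 'I_m.+2) : i = j :> nat ->
  form_coef i = ('X_j)%:P.
Proof. by move=> ij; rewrite /form_coef /= ij valK. Qed.

Lemma form_coef_penult (i : 'I_m.+2) : i = m :> nat ->
  form_coef i = - form_head^`().
Proof. by move=> im; rewrite /form_coef /= im insubF ?ltnn // eqxx. Qed.

Lemma form_coef_last (i : 'I_m.+2) : i = m.+1 :> nat ->
  form_coef i = 'X * form_head^`() - form_head.
Proof.
by move=> im; rewrite /form_coef /= im insubF ?ltnNge ?leqnSn // gtn_eqF.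
Qed.

Lemma form_coefP (P : E -> Prop) : (forall j, P ('X_j)%:P) ->
  P (- form_head^`()) -> P ('X * form_head^`() - form_head) ->
  forall i, P (form_coef i).
Proof.
move=> PX P1 P2 i; rewrite /form_coef; case: insubP => // _.
by case: ifP.
Qed.

End Normalization.

(** The comorphism of the projection to Delta.  It is locked: comparing the images
    of two different polynomials would otherwise unfold both. *)
HB.lock Definition form_subst (K : fieldType) (m : nat) :
    {mpoly K[m.+2]} -> {poly {mpoly K[m]}} :=
  mmap (polyC \o @mpolyC m K) (@form_coef K m).

Section FormSubst.
Variables (K : fieldType) (m : nat).
Local Notation form_subst := (@form_subst K m).

Lemma form_substD : {morph form_subst : p q / p + q}.
Proof. by rewrite form_subst.unlock; apply: raddfD. Qed.

Lemma form_substN : {morph form_subst : p / - p}.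
Proof. by rewrite form_subst.unlock; apply: raddfN. Qed.

Lemma form_substM : {morph form_subst : p q / p * q}.
Proof. by rewrite form_subst.unlock; apply: rmorphM. Qed.

Lemma form_substC c : form_subst c%:MP = (c%:MP)%:P.
Proof. by rewrite form_subst.unlock; apply: mmapC. Qed.

Lemma form_substX i : form_subst 'X_i = form_coef K i.
Proof. by rewrite form_subst.unlock mmapX mmap1U. Qed.

Lemma form_subst1 : form_subst 1 = 1.
Proof. by rewrite -mpolyC1 form_substC mpolyC1. Qed.

Fact form_subst_zmod_morphism : zmod_morphism form_subst.
Proof. by move=> p q; rewrite form_substD form_substN. Qed.

Fact form_subst_monoid_morphism : monoid_morphism form_subst.
Proof. by split; [apply: form_subst1|apply: form_substM]. Qed.

HB.instance Definition _ := GRing.isZmodMorphism.Build {mpoly K[m.+2]}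
  {poly {mpoly K[m]}} form_subst form_subst_zmod_morphism.
HB.instance Definition _ := GRing.isMonoidMorphism.Build {mpoly K[m.+2]}
  {poly {mpoly K[m]}} form_subst form_subst_monoid_morphism.

End FormSubst.

Section Swallow.
Variables (K : fieldType) (charK : [pchar K] =i pred0) (m : nat).
Local Notation C := {mpoly K[m]}.
Local Notation E := {poly C}.
Local Notation form_head := (form_head K m).
Local Notation form_coef := (@form_coef K m).
Local Notation form_subst := (@form_subst K m).

Lemma form_subst_ind (P : E -> Prop) :
    (forall c, P (c%:MP)%:P) -> (forall j, P ('X_j)%:P) ->
    P (- form_head^`()) -> P ('X * form_head^`() - form_head) ->
    (forall p q, P p -> P q -> P (p + q)) ->
    (forall p q, P p -> P q -> P (p * q)) ->
  forall q, P (form_subst q).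
Proof.
move=> PC PX P1 P2 PD PM; apply: mpoly_ring_ind => [c|i|p q Pp Pq|p q Pp Pq].
- by rewrite form_substC.
- by rewrite form_substX; apply: form_coefP.
- by rewrite form_substD; apply: PD.
- by rewrite form_substM; apply: PM.
Qed.

Lemma form_subst_const (c : C) : exists q, form_subst q = c%:P.
Proof.
elim/mpoly_ring_ind: c => [c|j|p q [p' Ep] [q' Eq]|p q [p' Ep] [q' Eq]].
- by exists c%:MP; rewrite form_substC.
- have lt_j : (j < m.+2)%N.
    by rewrite (leq_trans (ltn_ord j)) // -addn2 leq_addr.
  by exists 'X_(Ordinal lt_j); rewrite form_substX (@form_coef_widen K m j).
- by exists (p' + q'); rewrite form_substD Ep Eq polyCD.
- by exists (p' * q'); rewrite form_substM Ep Eq polyCM.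
Qed.

(** Up to sign and a factor t, the t-derivatives of a_(n-1) and a_n; it cuts out
    the ramification of barDelta over Delta. *)
Definition jac : E := form_head^`()^`().

Definition in_swallowtail (e : E) : Prop := exists g, e^`() = jac * g.

Lemma swallowD p q :
  in_swallowtail p -> in_swallowtail q -> in_swallowtail (p + q).
Proof.
by move=> [g Eg] [k Ek]; exists (g + k); rewrite derivD Eg Ek mulrDr.
Qed.

Lemma swallowM p q :
  in_swallowtail p -> in_swallowtail q -> in_swallowtail (p * q).
Proof.
move=> [g Eg] [k Ek]; exists (g * q + p * k); rewrite derivM Eg Ek.
by rewrite mulrDr !mulrA [p * jac]mulrC.
Qed.

Lemma swallowC c : in_swallowtail c%:P.
Proof. by exists 0; rewrite derivC mulr0. Qed.

Lemma swallowB p q :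
  in_swallowtail p -> in_swallowtail q -> in_swallowtail (p - q).
Proof.
by move=> [g Eg] [k Ek]; exists (g - k); rewrite derivB Eg Ek mulrBr.
Qed.

Lemma swallow_penult : in_swallowtail (- form_head^`()).
Proof. by exists (- 1); rewrite derivN mulrN1. Qed.

Lemma deriv_last : ('X * form_head^`() - form_head)^`() = jac * 'X.
Proof.
by rewrite derivB derivM derivX mul1r addrAC subrr add0r mulrC.
Qed.

Lemma swallow_form_subst q : in_swallowtail (form_subst q).
Proof.
apply: form_subst_ind q => [c|j|||p q|p q].
- exact: swallowC.
- exact: swallowC.
- exact: swallow_penult.
- by exists 'X; rewrite deriv_last.
- exact: swallowD.
- exact: swallowM.
Qed.

(** Together with 1, a C-basis of the swallowtail. *)
Definition prim k : E := antideriv (jac * 'X^k).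

Lemma deriv_prim k : (prim k)^`() = jac * 'X^k.
Proof. exact: (antiderivK charK). Qed.

Lemma swallow_prim k : in_swallowtail (prim k).
Proof. by exists 'X^k; rewrite deriv_prim. Qed.

Lemma eq_deriv_form_subst e q : e^`() = (form_subst q)^`() ->
  exists q', e = form_subst q'.
Proof.
move/eqP; rewrite -subr_eq0 -derivB => /eqP /(deriv_eq0 charK) E0.
have [c Ec] := form_subst_const (e - form_subst q)`_0.
by exists (q + c); rewrite form_substD Ec -E0 addrC subrK.
Qed.

(** prim 0 and - a_(n-1) have the same t-derivative. *)
Lemma prim0_form_subst : exists q, prim 0 = form_subst q.
Proof.
apply: (@eq_deriv_form_subst _ (- 'X_(Ordinal (leqnSn m.+1)))).
rewrite form_substN form_substX form_coef_penult // opprK deriv_prim.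
by rewrite expr0 mulr1.
Qed.

(** prim 1 and a_n have the same t-derivative. *)
Lemma prim1_form_subst : exists q, prim 1 = form_subst q.
Proof.
apply: (@eq_deriv_form_subst _ 'X_ord_max).
by rewrite form_substX form_coef_last // deriv_last deriv_prim expr1.
Qed.

Lemma coef_form_head_ge i : (m.+1 < i)%N -> form_head`_i = (i == m.+2)%:R.
Proof.
move=> lt_i; rewrite /form_head coefD coefXn coef_sum big1 ?addr0 // => j _.
rewrite coefCM coefXn gtn_eqF ?mulr0 //.
by rewrite (leq_ltn_trans _ lt_i) // leq_subr.
Qed.

Definition jac_lead : nat := (m.+1 * m.+2)%N.

Lemma coef_jac i : (m <= i)%N -> jac`_i = ((i == m) * jac_lead)%N%:R.
Proof.
move=> le_i; rewrite /jac !coef_deriv coef_form_head_ge // !eqSS.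
by case: eqP => [->|_]; rewrite ?mul0n ?mul0rn // mul1n -mulrnA mulnC.
Qed.

Lemma jac_lead_neq0 : jac_lead%:R != 0 :> K.
Proof. exact: natr_neq0. Qed.

Lemma natr_mpolyC n : n%:R = (n%:R : K)%:MP :> C.
Proof. by rewrite rmorph_nat. Qed.

Lemma size_jac : size jac = m.+1.
Proof.
apply/eqP; rewrite eqn_leq; apply/andP; split.
  apply/leq_sizeP => i lt_i; rewrite coef_jac ?(ltnW lt_i) //.
  by rewrite gtn_eqF.
rewrite ltnNge; apply/negP => /leq_sizeP /(_ m (leqnn m)) /eqP.
by rewrite coef_jac // eqxx mul1n natr_mpolyC mpolyC_eq0 (negPf jac_lead_neq0).
Qed.

Lemma jac_neq0 : jac != 0.
Proof. by rewrite -size_poly_eq0 size_jac. Qed.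

Lemma coef_prim k i : (m + k < i)%N ->
  (prim k)`_i = (((i == (m + k).+1) * jac_lead)%N%:R / i%:R : K)%:MP.
Proof.
case: i => // i; rewrite ltnS eqSS => le_i; rewrite coef_antideriv /= coefMXn.
rewrite ltnNge (leq_trans (leq_addl _ _) le_i) /= coef_jac; last by lia.
have -> : (i - k == m)%N = (i == m + k)%N by apply/eqP/eqP; lia.
by rewrite natr_mpolyC -mul_mpolyC -mpolyCM mulrC.
Qed.

Lemma size_prim k : (size (prim k) <= (m + k).+2)%N.
Proof.
apply/leq_sizeP => i lt_i; rewrite coef_prim ?(ltnW lt_i) //.
by rewrite gtn_eqF // mul0n mul0r.
Qed.

Definition prim_lead k : K := jac_lead%:R / ((m + k).+1)%:R.

Lemma prim_lead_neq0 k : prim_lead k != 0.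
Proof. by rewrite mulf_neq0 ?jac_lead_neq0 // invr_eq0 natr_neq0. Qed.

Lemma lead_prim k : (prim k)`_(m + k).+1 = (prim_lead k)%:MP.
Proof. by rewrite coef_prim // eqxx mul1n. Qed.

Hypothesis m_gt0 : (0 < m)%N.

(** The primitives of index 0 and 1 are omitted, because they come from O_Delta. *)
Definition gens (i : 'I_m) : E := if i == 0 :> nat then 1 else prim i.+1.

Definition spanned (e : E) : Prop :=
  exists c : 'I_m -> {mpoly K[m.+2]}, e = \sum_i form_subst (c i) * gens i.

Lemma spannedD p q : spanned p -> spanned q -> spanned (p + q).
Proof.
move=> [c ->] [d ->]; exists (fun i => c i + d i); rewrite -big_split.
by apply: eq_bigr => i _; rewrite form_substD mulrDl.
Qed.

Lemma spannedM q e : spanned e -> spanned (form_subst q * e).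
Proof.
move=> [c ->]; exists (fun i => q * c i); rewrite [LHS]mulr_sumr.
by apply: eq_bigr => i _; rewrite form_substM mulrA.
Qed.

Lemma spannedCM (c : C) e : spanned e -> spanned (c%:P * e).
Proof. by have [q <-] := form_subst_const c; apply: spannedM. Qed.

Lemma spanned_gens i : spanned (gens i).
Proof.
exists (fun j => (j == i)%:R); rewrite (bigD1 i) //= eqxx rmorph1 mul1r.
rewrite big1 ?addr0 // => j /negPf ->.
by rewrite rmorph0 mul0r.
Qed.

Lemma spanned1 : spanned 1.
Proof.
have -> : 1 = gens (Ordinal m_gt0) by [].
exact: spanned_gens.
Qed.

Lemma spanned0 : spanned 0.
Proof. by rewrite -[0](mul0r 1) -polyC0; apply/spannedCM/spanned1. Qed.

Lemma spanned_form_subst q : spanned (form_subst q).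
Proof. by rewrite -[form_subst q]mulr1; apply/spannedM/spanned1. Qed.

Lemma spanned_prim_small k : (k <= m)%N -> spanned (prim k).
Proof.
case: k => [|[|k]] le_k.
- by have [q ->] := prim0_form_subst; apply: spanned_form_subst.
- by have [q ->] := prim1_form_subst; apply: spanned_form_subst.
- have -> : prim k.+2 = gens (Ordinal le_k) by [].
  exact: spanned_gens.
Qed.

(** A nonconstant element has a derivative divisible by jac, of degree m. *)
Lemma swallow_small e : in_swallowtail e -> (size e <= m.+1)%N -> e = (e`_0)%:P.
Proof.
move=> [g Eg] sz; apply: (deriv_eq0 charK); rewrite Eg.
have [->|g0] := eqVneq g 0; first by rewrite mulr0.
have [e0|e0] := eqVneq e 0; first by rewrite -Eg e0 derivC.
have := leq_trans (lt_size_deriv e0) sz; rewrite Eg size_mul ?jac_neq0 //.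
rewrite size_jac; have := size_poly_gt0 g; rewrite g0.
by case: (size g) => // k _; lia.
Qed.

(** Cancelling the leading term of e with the help of w lowers the degree without
    leaving the swallowtail. *)
Lemma spanned_reduce N k w e :
    (forall p, in_swallowtail p -> (size p <= N)%N -> spanned p) ->
    in_swallowtail w -> spanned w -> (size w <= N.+1)%N ->
    w`_N = k%:MP -> k != 0 ->
    in_swallowtail e -> (size e <= N.+1)%N ->
  spanned e.
Proof.
move=> IH cw sw szw wN k0 ce sze.
set d : E := (k^-1 *: e`_N)%:P * w.
rewrite -[e](subrK d); apply: spannedD; last exact: spannedCM.
apply: IH.
  by apply: swallowB => //; apply: swallowM => //; apply: swallowC.
apply/leq_sizeP => i; rewrite leq_eqVlt => /predU1P[<-|lt_i].
  rewrite coefB coefCM wN mulrC mul_mpolyC scalerA divff // scale1r subrr //.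
rewrite coefB coefCM (nth_default _ (leq_trans sze lt_i)).
by rewrite (nth_default _ (leq_trans szw lt_i)) mulr0 subrr.
Qed.

(** In each degree N = m + k + 1 there is a spanned element with constant leading
    coefficient: prim k for k <= m, and otherwise prim 0 * prim (k - m - 1), whose
    first factor comes from O_Delta and whose second one has smaller degree. *)
Lemma swallow_spanned e : in_swallowtail e -> spanned e.
Proof.
move: (leqnn (size e)); move: {2}(size e) => N.
elim: N e => [|N IH] e sze ce.
  by move: sze; rewrite leqn0 size_poly_eq0 => /eqP ->; apply: spanned0.
have [small|big] := leqP (size e) m.+1.
  by rewrite (swallow_small ce small) -[_%:P]mulr1; apply/spannedCM/spanned1.
have {}IH p : in_swallowtail p -> (size p <= N)%N -> spanned p.
  by move=> cp szp; apply: IH.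
have [k Nk] : exists k, N = (m + k).+1 by exists (N - m.+1)%N; lia.
case: (leqP k m) => [le_k|lt_k].
  apply: (spanned_reduce IH (swallow_prim k) _ _ _ (prim_lead_neq0 k)) => //.
  - exact: spanned_prim_small.
  - by rewrite Nk size_prim.
  - by rewrite Nk lead_prim.
(* In degree N the product prim 0 * prim j has a single contribution, that of the
   two leading terms. *)
pose j := (k - m.+1)%N; have [q prim0q] := prim0_form_subst.
have szj : (size (prim j) <= N)%N by apply: leq_trans (size_prim j) _; lia.
have e1 : N = ((m + 0).+1 + (m + j).+1)%N by lia.
apply: (@spanned_reduce N (prim_lead 0 * prim_lead j) (prim 0 * prim j)) => //.
- by apply: swallowM; apply: swallow_prim.
- by rewrite prim0q; apply/spannedM/IH => //; apply: swallow_prim.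
- apply: leq_trans (size_polyMleq _ _) _.
  by have := size_prim 0; have := size_prim j; lia.
- rewrite e1 mpolyCM -!lead_prim coefM.
  rewrite (bigD1 (inord (m + 0).+1)) //= inordK ?leq_addr ?ltnS ?leq_addr //.
  rewrite addKn big1 ?addr0 // => i.
  rewrite -val_eqE /= inordK ?ltnS ?leq_addr // neq_ltn => /orP[lt_i|gt_i].
    rewrite [(prim j)`_ _]nth_default ?mulr0 // (leq_trans (size_prim j)) //.
    by lia.
  by rewrite [(prim 0)`_ _]nth_default ?mul0r // (leq_trans (size_prim 0)) //.
- by rewrite mulf_neq0 ?prim_lead_neq0.
Qed.

End Swallow.

(** * Restriction to the forms with a_1 = ... = a_m = 0 *)
Section Restriction.
Variables (K : fieldType) (charK : [pchar K] =i pred0) (m : nat).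
Local Notation C := {mpoly K[m]}.
Local Notation E := {poly C}.
Local Notation form_head := (form_head K m).
Local Notation jac := (jac K m).

Definition restr : E -> {poly K} := map_poly (meval (fun=> 0)).

HB.instance Definition _ := GRing.RMorphism.on restr.

Lemma restrD : {morph restr : p q / p + q}.
Proof. exact: (rmorphD restr). Qed.

Lemma restrM : {morph restr : p q / p * q}.
Proof. exact: (rmorphM restr). Qed.

Lemma restrC c : restr c%:P = (c.@[fun=> 0])%:P.
Proof. exact: map_polyC. Qed.

Lemma restrX : restr 'X = 'X.
Proof. exact: map_polyX. Qed.

Lemma coef_restr e k : (restr e)`_k = (e`_k).@[fun=> 0].
Proof. exact: coef_map. Qed.

Lemma restr_deriv e : restr e^`() = (restr e)^`().
Proof. by rewrite /restr deriv_map. Qed.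

Lemma restr_form_head : restr form_head = 'X^(m.+2).
Proof.
rewrite /form_head restrD {1}/restr map_polyXn rmorph_sum big1 ?addr0 // => j _.
by rewrite /= restrM restrC mevalXU mul0r.
Qed.

Lemma restr_penult : restr (- form_head^`()) = - ('X^(m.+1) *+ m.+2).
Proof.
by rewrite (rmorphN restr) /= restr_deriv restr_form_head derivXn.
Qed.

Lemma restr_last : restr ('X * form_head^`() - form_head) = 'X^(m.+2) *+ m.+1.
Proof.
rewrite (rmorphB restr) /= restrM restr_deriv restr_form_head derivXn.
by rewrite restrX mulrnAr -exprS mulrS addrAC subrr add0r.
Qed.

Lemma restr_jac : restr jac = 'X^m *+ jac_lead m.
Proof.
by rewrite /jac !restr_deriv restr_form_head derivXn derivMn derivXn /= -mulrnA.
Qed.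

Lemma poly_mulrn_eq0 (p : {poly K}) k : (0 < k)%N -> p *+ k = 0 -> p = 0.
Proof.
move=> k0 /eqP; rewrite -scaler_nat scaler_eq0 (negPf (natr_neq0 charK k0)).
by move/eqP.
Qed.

(** The exponents that the numerical semigroup generated by m + 1 and m + 2 misses
    below 2m + 2. *)
Definition gapped (p : {poly K}) : Prop :=
  forall k, (0 < k <= m)%N || (m.+2 < k < m.+1.*2)%N -> p`_k = 0.

(** For products: if k is a gap and k = i + j with neither i nor j a gap, then i or
    j is 0, because the sum of two positive nongaps is at least 2m + 2. *)
Lemma gapped_form_subst q : gapped (restr (form_subst q)).
Proof.
apply: (form_subst_ind (P := fun e => gapped (restr e))) q
  => [c|j|||p q gp gq|p q gp gq] k gap.
- by rewrite restrC coefC; case: k gap.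
- by rewrite restrC coefC; case: k gap.
- rewrite restr_penult coefN coefMn coefXn.
  have -> : (k == m.+1) = false by apply/eqP; lia.
  by rewrite mul0rn oppr0.
- rewrite restr_last coefMn coefXn.
  have -> : (k == m.+2) = false by apply/eqP; lia.
  by rewrite mul0rn.
- by rewrite restrD coefD gp // gq // addr0.
rewrite restrM coefM big1 // => -[i /= lt_i] _.
have [->|i0] := posnP i; first by rewrite subn0 gq // mulr0.
case: (boolP ((0 < i <= m) || (m.+2 < i < m.+1.*2))%N) => [/gp ->|ngap].
  by rewrite mul0r.
have [ki|ki] := eqVneq k i; first by rewrite -ki gp // mul0r.
by rewrite gq ?mulr0 //; lia.
Qed.

Lemma swallow_low e k : in_swallowtail e -> (0 < k <= m)%N -> (restr e)`_k = 0.
Proof.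
case: k => // k [g Eg] /andP[_ lt_k].
have /eqP : (restr e)^`()`_k = 0.
  rewrite -restr_deriv Eg restrM restr_jac mulrnAl coefMn coefXnM lt_k.
  by rewrite mul0rn.
rewrite coef_deriv -mulr_natr mulf_eq0 (negPf (natr_neq0 charK _)) // orbF.
by move/eqP.
Qed.

(** Multiplying by a function on Delta whose restriction has no terms in
    t, ..., t^m only sees its value at the origin in these degrees. *)
Lemma coef_form_substM_low q e k : (k <= m)%N ->
  (restr (form_subst q * e))`_k = (restr (form_subst q))`_0 * (restr e)`_k.
Proof.
move=> le_k; rewrite restrM coefM big_ord_recl subn0 big1 ?addr0 //.
move=> -[i lt_i] _.
by rewrite gapped_form_subst ?mul0r //= /bump /=; lia.
Qed.

(** In a degree k of the second gap, a contribution other than that of the value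
    at the origin pairs t^(m+1) or t^(m+2) with an exponent of e between 1 and m,
    where elements of the swallowtail have no terms. *)
Lemma coef_form_substM_swallow q e k :
    in_swallowtail e -> (m.+2 < k < m.+1.*2)%N ->
  (restr (form_subst q * e))`_k = (restr (form_subst q))`_0 * (restr e)`_k.
Proof.
move=> se le_k; rewrite restrM coefM big_ord_recl subn0 big1 ?addr0 //.
move=> -[i lt_i] _; rewrite /= /bump /= add1n.
case: (boolP ((0 < i.+1 <= m) || (m.+2 < i.+1 < m.+1.*2))%N) => [gap|ngap].
  by rewrite gapped_form_subst // mul0r.
by rewrite [(restr e)`_ _]swallow_low ?mulr0 //; lia.
Qed.

Definition on_cusp (p : {poly K}) : Prop := exists q, restr (form_subst q) = p.

Lemma on_cuspD p q : on_cusp p -> on_cusp q -> on_cusp (p + q).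
Proof. by move=> [u <-] [v <-]; exists (u + v); rewrite form_substD restrD. Qed.

Lemma on_cuspM p q : on_cusp p -> on_cusp q -> on_cusp (p * q).
Proof. by move=> [u <-] [v <-]; exists (u * v); rewrite form_substM restrM. Qed.

Lemma on_cuspC c : on_cusp c%:P.
Proof. by exists c%:MP; rewrite form_substC restrC mevalC. Qed.

Lemma on_cuspX p n : on_cusp p -> on_cusp (p ^+ n).
Proof.
move=> pX; elim: n => [|n IH]; first exact: on_cuspC.
by rewrite exprS; apply: on_cuspM.
Qed.

Lemma on_cusp_scale p c : c != 0 -> on_cusp (c *: p) -> on_cusp p.
Proof.
move=> c0 pX; rewrite -[p]scale1r -(mulVf c0) -scalerA -mul_polyC.
by apply: on_cuspM => //; apply: on_cuspC.
Qed.

Lemma on_cusp_Xm1 : on_cusp 'X^(m.+1).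
Proof.
apply: (@on_cusp_scale _ (- (m.+2)%:R)); first by rewrite oppr_eq0 natr_neq0.
exists 'X_(Ordinal (leqnSn m.+1)).
by rewrite form_substX form_coef_penult // restr_penult scaleNr scaler_nat.
Qed.

Lemma on_cusp_Xm2 : on_cusp 'X^(m.+2).
Proof.
apply: (@on_cusp_scale _ (m.+1)%:R); first by rewrite natr_neq0.
exists 'X_ord_max.
by rewrite form_substX form_coef_last // restr_last scaler_nat.
Qed.

(** (m+1) D + i = (m+1) (D - i) + (m+2) i for i <= D. *)
Lemma on_cusp_conductor D (r : {poly K}) : (size r <= D.+1)%N ->
  on_cusp ('X^(m.+1 * D) * r).
Proof.
move=> sr; rewrite -[r]coefK poly_def mulr_sumr.
apply: big_ind => [||[i lt_i] _ /=]; [exact: (on_cuspC 0)|exact: on_cuspD|].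
rewrite -scalerAr -mul_polyC; apply: on_cuspM; first exact: on_cuspC.
have -> : 'X^(m.+1 * D) * 'X^i =
    ('X^(m.+1)) ^+ (D - i) * ('X^(m.+2)) ^+ i :> {poly K}.
  rewrite -!exprM -!exprD; congr (_ ^+ _).
  have le_i : (i <= D)%N by rewrite -ltnS (leq_trans lt_i).
  rewrite -{1}(subnK le_i) mulnDr mulSn; lia.
by apply: on_cuspM; apply: on_cuspX; [exact: on_cusp_Xm1|exact: on_cusp_Xm2].
Qed.

(** The origin's maximal ideal is generated by the variables. *)
Lemma mpoly_origin (c : C) :
  exists d : 'I_m -> C, c = (c.@[fun=> 0])%:MP + \sum_j 'X_j * d j.
Proof.
elim/mpoly_ring_ind: c => [c|j|p q [d Ep] [e Eq]|p q [d Ep] [e Eq]].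
- exists (fun=> 0); rewrite mevalC big1 ?addr0 // => j _.
  by rewrite mulr0.
- exists (fun i => (i == j)%:R); rewrite mevalXU (bigD1 j) //= eqxx mulr1.
  rewrite big1 => [|i /negPf ->]; last by rewrite mulr0.
  by rewrite addr0 add0r.
- exists (fun j => d j + e j); rewrite mevalD {1}Ep {1}Eq mpolyCD addrACA.
  by congr (_ + _); rewrite -big_split; apply: eq_bigr => j _; rewrite mulrDr.
exists (fun j => d j * q + (p.@[fun=> 0])%:MP * e j).
transitivity ((p.@[fun=> 0])%:MP * (q.@[fun=> 0])%:MP
  + ((\sum_j 'X_j * d j) * q + (p.@[fun=> 0])%:MP * \sum_j 'X_j * e j)).
  by rewrite [X in _ + X]addrC addrA -mulrDr -Eq -mulrDl -Ep.
rewrite mevalM mpolyCM mulr_suml mulr_sumr -big_split; congr (_ + _).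
by apply: eq_bigr => j _ /=; rewrite mulrDr -mulrA [_%:MP * (_ * _)]mulrCA.
Qed.

Lemma poly_origin (e : E) : exists d : 'I_m -> E,
  e = map_poly (@mpolyC m K) (restr e) + \sum_j ('X_j)%:P * d j.
Proof.
elim/poly_ind: e => [|e c [d Ed]].
  exists (fun=> 0); rewrite (rmorph0 restr) map_poly0 add0r big1 // => j _.
  by rewrite mulr0.
have [d' Ec] := mpoly_origin c.
exists (fun j => d j * 'X + (d' j)%:P).
rewrite restrD restrM restrC restrX (rmorphD (map_poly _)).
rewrite (rmorphM (map_poly _)) /= map_polyX map_polyC /=.
rewrite {1}Ed {1}Ec polyCD mulrDl addrACA.
congr (_ + _); rewrite mulr_suml (rmorph_sum polyC) -big_split.
apply: eq_bigr => j _ /=.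
by rewrite polyCM mulrDr mulrA.
Qed.

(** If e' = jac * g, then g restricts to 0 as well, because jac restricts to a
    nonzero monomial.  So g is a combination of the a_j, and integrating jac times
    its coefficients gives the required elements, up to a constant of C that also
    vanishes at the origin. *)
Lemma swallow_restr_eq0 e : in_swallowtail e -> restr e = 0 ->
  exists2 s : 'I_m -> E,
    forall j, in_swallowtail (s j) & e = \sum_j ('X_j)%:P * s j.
Proof.
move=> [g Eg] e0; have rg0 : restr g = 0.
  have /eqP : restr jac * restr g = 0.
    by rewrite -restrM -Eg restr_deriv e0 derivC.
  rewrite mulf_eq0 => /orP[|/eqP] //; rewrite restr_jac => /eqP /poly_mulrn_eq0.
  by move=> /(_ isT)/eqP; rewrite (negPf (monic_neq0 (monicXn _ _))).
have [d Ed] := poly_origin g; rewrite rg0 map_poly0 add0r in Ed.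
pose s0 j : E := antideriv (jac * d j).
pose r := e - \sum_j ('X_j)%:P * s0 j.
have r' : r^`() = 0.
  rewrite derivB raddf_sum /= Eg {1}Ed mulr_sumr; apply/eqP; rewrite subr_eq0.
  apply/eqP; apply: eq_bigr => j _.
  by rewrite derivM derivC mul0r add0r (antiderivK charK) mulrCA.
have [c Ec] : exists c, r = c%:P by exists r`_0; apply: (deriv_eq0 charK).
have [d0 Ed0] := mpoly_origin c.
have c0 : c.@[fun=> 0] = 0.
  have /(congr1 (coefp 0)) : restr r = 0.
    rewrite (rmorphB restr) /= e0 rmorph_sum big1 ?subr0 // => j _ /=.
    by rewrite restrM restrC mevalXU mul0r.
  by rewrite /= Ec restrC coefC coef0.
exists (fun j => s0 j + (d0 j)%:P).
  move=> j; apply: swallowD; last exact: swallowC.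
  by exists (d j); rewrite (antiderivK charK).
have -> : e = \sum_j ('X_j)%:P * s0 j + c%:P.
  by rewrite -Ec addrC subrK.
rewrite Ed0 c0 mpolyC0 add0r rmorph_sum -big_split; apply: eq_bigr => j _ /=.
by rewrite polyCM mulrDr.
Qed.

End Restriction.

(** * The coordinate ring of barDelta is C[t] *)

(** Locked for the same reason as [form_subst]. *)
HB.lock Definition param_subst (K : fieldType) (m : nat) :
    {mpoly K[m.+3]} -> {poly {mpoly K[m]}} :=
  mmap (polyC \o @mpolyC m K)
       (fun i => if unlift ord0 i is Some j then form_coef K j else 'X).

Section ParamSubst.
Variables (K : fieldType) (m : nat).

Fact param_subst_zmod_morphism : zmod_morphism (@param_subst K m).
Proof. by rewrite param_subst.unlock; apply: raddfB. Qed.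

Fact param_subst_monoid_morphism : monoid_morphism (@param_subst K m).
Proof.
by rewrite param_subst.unlock; split; [apply: rmorph1|apply: rmorphM].
Qed.

HB.instance Definition _ := GRing.isZmodMorphism.Build {mpoly K[m.+3]}
  {poly {mpoly K[m]}} (@param_subst K m) param_subst_zmod_morphism.
HB.instance Definition _ := GRing.isMonoidMorphism.Build {mpoly K[m.+3]}
  {poly {mpoly K[m]}} (@param_subst K m) param_subst_monoid_morphism.

Lemma param_substC c : @param_subst K m c%:MP = (c%:MP)%:P.
Proof. by rewrite param_subst.unlock; apply: mmapC. Qed.

Lemma param_substX i : @param_subst K m 'X_i =
  if unlift ord0 i is Some j then form_coef K j else 'X.
Proof. by rewrite param_subst.unlock mmapX mmap1U. Qed.

End ParamSubst.

Section Parametrization.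
Variables (K : closedFieldType) (charK : [pchar K] =i pred0) (m : nat).
Local Notation C := {mpoly K[m]}.
Local Notation E := {poly C}.
Local Notation form_head := (form_head K m).

Definition emb (j : 'I_m) : 'I_m.+2 :=
  widen_ord (leqnSn m.+1) (widen_ord (leqnSn m) j).
Definition penult : 'I_m.+2 := widen_ord (leqnSn m.+1) ord_max.

Lemma form_coef_emb j : form_coef K (emb j) = ('X_j)%:P.
Proof. exact: form_coef_widen. Qed.

Definition param (t : K) (a : 'I_m -> K) (i : 'I_m.+3) : K :=
  if unlift ord0 i is Some j then poly_ev t a (form_coef K j) else t.

Lemma form_coords_param t a j :
  form_coords (param t a) j = poly_ev t a (form_coef K j).
Proof. by rewrite /form_coords /param liftK. Qed.

Lemma poly_evE t (a : 'I_m -> K) e : poly_ev t a e = (map_poly (meval a) e).[t].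
Proof. by []. Qed.

Lemma map_form_head (a : 'I_m -> K) : map_poly (meval a) form_head =
  'X^(m.+2) + \sum_(j < m) a j *: 'X^(m.+1 - j).
Proof.
rewrite /form_head (rmorphD (map_poly _)) /= map_polyXn rmorph_sum.
congr (_ + _); apply: eq_bigr => j _.
rewrite (rmorphM (map_poly _)) /= map_polyXn map_polyC.
by rewrite /= mevalXU mul_polyC.
Qed.

Definition chart_poly (a : 'I_m.+2 -> K) : {poly K} :=
  \sum_(i < m.+3) chart a i *: 'X^(m.+2 - i).

Lemma chart_poly_eval a t : (bform (chart a)).@[pt t 1] = (chart_poly a).[t].
Proof.
rewrite bform_eval horner_sum; apply: eq_bigr => i _.
by rewrite hornerZ hornerXn expr1n mulr1.
Qed.

Lemma chart_poly_dx a t :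
  (bform (chart a))^`M(ord0).@[pt t 1] = (chart_poly a)^`().[t].
Proof.
rewrite bform_dx (raddf_sum (@deriv _)) horner_sum; apply: eq_bigr => i _ /=.
by rewrite derivZ derivXn hornerZ hornerMn hornerXn expr1n mulr1.
Qed.

Lemma chart_polyE a : chart_poly a =
  map_poly (meval (fun j => a (emb j))) form_head + a penult *: 'X
  + (a ord_max)%:P.
Proof.
rewrite /chart_poly big_ord_recl /chart unlift_none scale1r subn0.
under eq_bigr do rewrite liftK.
rewrite map_form_head 2!big_ord_recr /= !addrA.
have -> : (m.+2 - bump 0 m.+1 = 0)%N by rewrite /bump /=; lia.
have -> : (m.+2 - bump 0 m = 1)%N by rewrite /bump /=; lia.
by rewrite alg_polyC.
Qed.

(** Given F_x = 0, Euler's relation makes F_y = 0 and F = 0 equivalent at the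
    point (t : 1). *)
Lemma barDelta_aff_ptsE (v : 'I_m.+3 -> K) : barDelta_aff_pts v <->
  (chart_poly (form_coords v))^`().[root_coord v] = 0 /\
  (chart_poly (form_coords v)).[root_coord v] = 0.
Proof.
set t := root_coord v; set a := form_coords v.
rewrite -chart_poly_dx -chart_poly_eval; split => [[_ _ dx dy]|[dx f0]].
  by split => //; apply: bform_eq0.
split=> //; [exact: chart_neq0|by rewrite oner_eq0 orbT|].
have := bform_euler (chart a) t 1.
by rewrite dx f0 mul0rn mulr0 add0r mul1r.
Qed.

Lemma barDelta_aff_pts_coords (v : 'I_m.+3 -> K) :
  let t := root_coord v in let a := form_coords v in
  let p := map_poly (meval (fun j => a (emb j))) form_head in
  barDelta_aff_pts v <->
  a penult = - p^`().[t] /\ a ord_max = t * p^`().[t] - p.[t].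
Proof.
move=> t a p; rewrite barDelta_aff_ptsE -/t -/a chart_polyE -/p.
rewrite !derivD derivZ derivX derivC !hornerE.
split=> [[/eqP dx /eqP f]|[-> ->]]; last by split; ring.
have a1 : a penult = - p^`().[t] by apply/eqP; rewrite -addr_eq0 addrC.
split=> //; move: f; rewrite a1 addrC addr_eq0 => /eqP ->; ring.
Qed.

Lemma param_barDelta t a : barDelta_aff_pts (param t a).
Proof.
apply/barDelta_aff_pts_coords; rewrite !form_coords_param.
have -> : root_coord (param t a) = t by rewrite /root_coord /param unlift_none.
have -> : (fun j => form_coords (param t a) (emb j)) = a.
  apply/funext => j; rewrite form_coords_param form_coef_emb poly_evC.
  exact: mevalXU.
rewrite form_coef_penult // form_coef_last //.
rewrite poly_evN poly_evB poly_evM poly_evX.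
by rewrite !poly_evE -deriv_map.
Qed.

Lemma barDelta_param v : barDelta_aff_pts v ->
  v = param (root_coord v) (fun j => form_coords v (emb j)).
Proof.
move/barDelta_aff_pts_coords => [v1 v2]; apply/funext => i.
rewrite /param; case: unliftP => [j ->|-> //].
rewrite -/(form_coords v j).
have [jm|jm|jm] := ltngtP j m.
- have -> : j = emb (Ordinal jm) by apply: val_inj.
  by rewrite form_coef_emb poly_evC mevalXU.
- have -> : j = ord_max.
    by apply/val_inj/eqP; rewrite eqn_leq jm -ltnS ltn_ord.
  rewrite v2 form_coef_last // poly_evB poly_evM poly_evX.
  by rewrite !poly_evE -deriv_map.
have -> : j = penult by apply: val_inj.
by rewrite v1 form_coef_penult // poly_evN poly_evE -deriv_map.
Qed.

Local Notation param_subst := (@param_subst K m).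

Lemma param_subst_ev p t a : poly_ev t a (param_subst p) = p.@[param t a].
Proof.
pose f : {rmorphism _ -> K} := poly_ev t a \o param_subst.
apply: (@mpoly_rmorph_ext _ _ _ f (meval _)) => [c|i]; rewrite /f /=.
  by rewrite param_substC poly_evC !mevalC.
rewrite param_substX mevalXU /param; case: unliftP => [j _|_] //.
by rewrite poly_evX.
Qed.

(** barDelta is the image of the parametrization, and a polynomial in t with
    coefficients in C is determined by its values. *)
Lemma param_subst_eqP p q : param_subst p = param_subst q <->
  (forall v, barDelta_aff_pts v -> p.@[v] = q.@[v]).
Proof.
split=> [e v /barDelta_param ->|e]; first by rewrite -!param_subst_ev e.
have ev0 t a : poly_ev t a (param_subst p - param_subst q) = 0.
  by rewrite poly_evB !param_subst_ev (e _ (param_barDelta t a)) subrr.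
apply/eqP; rewrite -subr_eq0; apply/eqP; apply: (poly_ev_eq0 charK) ev0.
by move=> c c0; apply: (mpoly_eval_eq0 charK).
Qed.

Definition param_lift_coef : C -> {mpoly K[m.+3]} :=
  mmap (@mpolyC m.+3 K) (fun j => 'X_(lift ord0 (emb j))).

HB.instance Definition _ := GRing.RMorphism.on param_lift_coef.

Definition param_lift : E -> {mpoly K[m.+3]} :=
  horner_eval 'X_ord0 \o map_poly param_lift_coef.

HB.instance Definition _ := GRing.RMorphism.on param_lift.

Lemma param_liftC c : param_lift c%:P = param_lift_coef c.
Proof. by rewrite /param_lift /= map_polyC /horner_eval hornerC. Qed.

Lemma param_liftX : param_lift 'X = 'X_ord0.
Proof. by rewrite /param_lift /= map_polyX /horner_eval hornerX. Qed.

Lemma param_liftK : cancel param_lift param_subst.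
Proof.
have KC c : param_subst (param_lift_coef c) = c%:P.
  pose f : {rmorphism C -> E} := param_subst \o param_lift_coef.
  apply: (@mpoly_rmorph_ext _ _ _ f polyC) => [k|j]; rewrite /f /=.
    by rewrite /param_lift_coef mmapC param_substC.
  rewrite /param_lift_coef mmapX mmap1U param_substX liftK.
  exact: form_coef_emb.
elim/poly_ind => [|p c IH]; first by rewrite !rmorph0.
rewrite (rmorphD param_lift) (rmorphM param_lift).
rewrite (rmorphD param_subst) (rmorphM param_subst) /= IH.
rewrite param_liftC param_liftX.
by rewrite param_substX unlift_none KC.
Qed.

End Parametrization.

(** * The swallowtail inside C[t] *)
Section Swallowtail.
Variables (K : closedFieldType) (charK : [pchar K] =i pred0) (m : nat).
Variable (n_gt1 : (1 < m.+2)%N).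
Local Notation C := {mpoly K[m]}.
Local Notation E := {poly C}.
Local Notation A := (O_Delta charK n_gt1).
Local Notation B := (pi_O_barDelta charK n_gt1).
Local Notation S := (swallowtail charK n_gt1).
Local Notation regA := (reg (Delta_aff charK n_gt1)).
Local Notation regB := (reg (barDelta_aff K n_gt1)).

Definition barDelta_poly (b : B) : E := param_subst (repr (b : {ideal_quot _})).

Lemma barDelta_poly_reg p : barDelta_poly (regB p) = param_subst p.
Proof.
apply/(param_subst_eqP charK); apply/(@reg_eqP _ _ (barDelta_aff K n_gt1)).
exact: reprK.
Qed.

Lemma barDelta_poly_inj : injective barDelta_poly.
Proof.
move=> b c /(param_subst_eqP charK) e; rewrite -[b]reprK -[c]reprK.
exact/(@reg_eqP _ _ (barDelta_aff K n_gt1)).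
Qed.

Fact barDelta_poly_zmod_morphism : zmod_morphism barDelta_poly.
Proof.
move=> b c; rewrite -[b]reprK -[c]reprK -[in LHS]raddfB /=.
by rewrite -!/(reg (barDelta_aff K n_gt1) _) !barDelta_poly_reg rmorphB.
Qed.

Fact barDelta_poly_monoid_morphism : monoid_morphism barDelta_poly.
Proof.
split=> [|b c].
  have -> : (1 : B) = regB 1 by rewrite /reg rmorph1.
  by rewrite barDelta_poly_reg rmorph1.
rewrite -[b]reprK -[c]reprK -[in LHS]rmorphM /=.
by rewrite -!/(reg (barDelta_aff K n_gt1) _) !barDelta_poly_reg rmorphM.
Qed.

HB.instance Definition _ := GRing.isZmodMorphism.Build B E
  barDelta_poly barDelta_poly_zmod_morphism.
HB.instance Definition _ := GRing.isMonoidMorphism.Build B E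
  barDelta_poly barDelta_poly_monoid_morphism.

Definition barDelta_fun (e : E) : B := regB (param_lift e).

Lemma barDelta_funK : cancel barDelta_fun barDelta_poly.
Proof. by move=> e; rewrite barDelta_poly_reg param_liftK. Qed.

Lemma barDelta_polyK : cancel barDelta_poly barDelta_fun.
Proof. by move=> b; apply: barDelta_poly_inj; rewrite barDelta_funK. Qed.

Fact barDelta_fun_zmod_morphism : zmod_morphism barDelta_fun.
Proof.
by move=> p q; apply: barDelta_poly_inj; rewrite raddfB /= !barDelta_funK.
Qed.

Fact barDelta_fun_monoid_morphism : monoid_morphism barDelta_fun.
Proof.
split=> [|p q]; apply: barDelta_poly_inj; rewrite barDelta_funK.
  by rewrite (rmorph1 barDelta_poly).
by rewrite (rmorphM barDelta_poly) /= !barDelta_funK.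
Qed.

HB.instance Definition _ := GRing.isZmodMorphism.Build E B
  barDelta_fun barDelta_fun_zmod_morphism.
HB.instance Definition _ := GRing.isMonoidMorphism.Build E B
  barDelta_fun barDelta_fun_monoid_morphism.

Lemma barDelta_poly_pi_sharp q :
  barDelta_poly (pi_sharp (charK := charK) (n_gt1 := n_gt1) (regA q)) =
  form_subst q.
Proof.
rewrite pi_sharp_reg barDelta_poly_reg.
pose f : {rmorphism {mpoly K[m.+2]} -> E} :=
  @param_subst K m \o comp_mpoly [tuple 'X_(lift ord0 i) | i < m.+2].
apply: (@mpoly_rmorph_ext _ _ _ f (@form_subst K m)) => [c|i]; rewrite /f /=.
  by rewrite comp_mpolyC param_substC form_substC.
by rewrite comp_mpolyXU -tnth_nth tnth_mktuple param_substX liftK form_substX.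
Qed.

(** The ring map along which O_Delta acts on C[t]. *)
Definition O_Delta_poly : A -> E :=
  barDelta_poly \o pi_sharp (charK := charK) (n_gt1 := n_gt1).

HB.instance Definition _ := GRing.RMorphism.on O_Delta_poly.

Lemma O_Delta_poly_reg q : O_Delta_poly (regA q) = form_subst q.
Proof. exact: barDelta_poly_pi_sharp. Qed.

Lemma O_Delta_poly_form_subst a : exists q, O_Delta_poly a = form_subst q.
Proof.
by exists (repr (a : {ideal_quot _})); rewrite -O_Delta_poly_reg /reg reprK.
Qed.

Lemma barDelta_poly_scale (a : A) (b : B) :
  barDelta_poly (a *: b) = O_Delta_poly a * barDelta_poly b.
Proof. by rewrite along_scaleE (rmorphM barDelta_poly). Qed.

Lemma univ_der_form_subst b q : barDelta_poly b = form_subst q ->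
  univ_der (b : B) = 0.
Proof.
move=> Eq; have -> : b = (regA q)%:A :> B.
  apply: barDelta_poly_inj; rewrite barDelta_poly_scale.
  by rewrite (rmorph1 barDelta_poly) mulr1 O_Delta_poly_reg.
exact: univ_der_const.
Qed.

(** If d b = 0, then b' is a multiple of jac by the universal property applied to
    d/dt, since d/dt sends O_Delta into the ideal of jac.  Conversely d b = b' dt,
    and jac dt = d (prim 0) = 0 as prim 0 comes from O_Delta. *)
Lemma univ_der_ker_swallow (b : B) :
  b \in univ_der_ker (B := B) <-> in_swallowtail (barDelta_poly b).
Proof.
split=> [/eqP db|[g Eg]].
  pose J (x : E) := exists g, x = jac K m * g.
  apply: (@univ_der_eq0_derivation A B E barDelta_poly
    (fun b => (barDelta_poly b)^`()) J) db.
  - by move=> x y; rewrite (rmorphD barDelta_poly) derivD.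
  - move=> x y; rewrite (rmorphM barDelta_poly) derivM addrC.
    by rewrite [X in _ + X]mulrC.
  - by exists 0; rewrite mulr0.
  - by move=> x y [g ->] [k ->]; exists (g + k); rewrite mulrDr.
  - by move=> x y [g ->]; exists (x * g); rewrite mulrCA.
  - move=> a; rewrite barDelta_poly_scale (rmorph1 barDelta_poly) mulr1.
    by have [q ->] := O_Delta_poly_form_subst a; apply: swallow_form_subst.
apply/eqP; rewrite -[b]barDelta_polyK.
have dC (c : C) : univ_der (barDelta_fun c%:P : B) = 0.
  have [q Eq] := form_subst_const c.
  by apply: (@univ_der_form_subst _ q); rewrite barDelta_funK.
rewrite (univ_der_poly _ dC) Eg mulrC (rmorphM barDelta_fun) -scalerA.
have [q Eq] : exists q, prim K m 0 = form_subst q by apply: prim0_form_subst.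
have -> : barDelta_fun (jac K m) *: univ_der (barDelta_fun 'X : B) = 0;
  last by rewrite scaler0.
have d0 : (prim K m 0)^`() = jac K m.
  by rewrite (deriv_prim charK) expr0 mulr1.
rewrite -d0 -(univ_der_poly _ dC) /=.
by apply: (@univ_der_form_subst _ q); rewrite barDelta_funK.
Qed.

Definition swallow_poly (s : S) : E := barDelta_poly (kernel_val s).

Lemma swallow_poly_swallow s : in_swallowtail (swallow_poly s).
Proof. by apply/univ_der_ker_swallow; case: s. Qed.

Lemma swallow_poly_inj : injective swallow_poly.
Proof. by move=> s t /barDelta_poly_inj /val_inj. Qed.

Lemma swallow_poly_onto e : in_swallowtail e -> exists s, swallow_poly s = e.
Proof.
move=> se; have ker : barDelta_fun e \in univ_der_ker (B := B).
  by apply/univ_der_ker_swallow; rewrite barDelta_funK.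
by exists (KernelOfD ker); rewrite /swallow_poly /= barDelta_funK.
Qed.

Lemma swallow_polyD : {morph swallow_poly : s t / s + t}.
Proof. by move=> s t; rewrite /swallow_poly -(rmorphD barDelta_poly). Qed.

Lemma swallow_poly0 : swallow_poly 0 = 0.
Proof. by apply: (addrI (swallow_poly 0)); rewrite -swallow_polyD !addr0. Qed.

Lemma swallow_poly_sum (I : Type) (r : seq I) (F : I -> S) :
  swallow_poly (\sum_(i <- r) F i) = \sum_(i <- r) swallow_poly (F i).
Proof. exact: (big_morph _ swallow_polyD swallow_poly0). Qed.

Lemma swallow_polyZ a s :
  swallow_poly (a *: s) = O_Delta_poly a * swallow_poly s.
Proof. by rewrite /swallow_poly -barDelta_poly_scale. Qed.

End Swallowtail.

(** * Free modules *)
Lemma linear_scaleB (R : comNzRingType) (M N : lmodType R)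
    (f : {linear M -> N}) a b (u v : M) :
  f (a *: u - b *: v) = a *: f u + (- b) *: f v.
Proof. by rewrite linearB !(linearZ_LR f) scaleNr. Qed.

Lemma linear_sumZ (R : comNzRingType) (M N : lmodType R) (f : {linear M -> N})
    (I : Type) (r : seq I) (c : I -> R) (u : I -> M) :
  f (\sum_(i <- r) c i *: u i) = \sum_(i <- r) c i *: f (u i).
Proof. by rewrite linear_sum; apply: eq_bigr => i _; rewrite linearZ_LR. Qed.

Lemma generates_iso (R : comNzRingType) (M N : lmodType R) (k : nat)
    (g : 'I_k -> M) (f : {linear M -> N}) :
  generates g -> bijective f -> generates (f \o g).
Proof.
move=> gen [h hK fK] v; have [c Ec] := gen (h v).
by exists c; rewrite -[v]fK Ec linear_sumZ.
Qed.

Section FreeModules.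
Import monalg.

(** The coordinates of both sides at i and at j: those on the right lie in the
    ideal generated by the c k, which h kills. *)
Lemma malg_pair_ideal (R P : comNzRingType) (h : {rmorphism R -> P})
    (I : choiceType) (n : nat) (c : 'I_n -> R) (w : 'I_n -> {malg R[I]})
    (i j : I) (a b : R) :
    i != j -> a *: mkmalgU i 1 - b *: mkmalgU j 1 = \sum_k c k *: w k ->
    (forall k, h (c k) = 0) ->
  h a = 0 /\ h b = 0.
Proof.
move=> neq_ij Eu c0.
have h_coef k : h (mcoeff k (a *: mkmalgU i 1 - b *: mkmalgU j 1)) = 0.
  rewrite Eu (raddf_sum (mcoeff k)) rmorph_sum big1 // => l _ /=.
  by rewrite mcoeffZ rmorphM c0 mul0r.
have := h_coef j; have := h_coef i.
rewrite !mcoeffB !mcoeffZ !mcoeffU !eqxx eq_sym (negPf neq_ij).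
rewrite !mulr0 subr0 sub0r !mulr1 rmorphN => -> /eqP.
by rewrite oppr_eq0 => /eqP.
Qed.

Lemma malg_generated_by_one (R : comNzRingType) (I : choiceType) :
    (forall i j : I, i = j) ->
  exists g : 'I_1 -> {malg R[I]},
    generates (g : _ -> ({malg R[I]} : lmodType R)).
Proof.
move=> eqI; case: (pselect (exists i : I, True)) => [[i0 _]|noI].
  exists (fun=> mkmalgU i0 1) => u; exists (fun=> mcoeff i0 u).
  rewrite big_ord1; apply/malgP => i; rewrite mcoeffZ mcoeffU (eqI i i0) eqxx.
  by rewrite mulr1.
exists (fun=> 0) => u; exists (fun=> 0); apply/malgP => i.
by case: noI; exists i.
Qed.

End FreeModules.

(** * Generators, lower bounds and freeness *)
Section Main.
Variables (K : closedFieldType) (charK : [pchar K] =i pred0) (m : nat).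
Variable (n_gt1 : (1 < m.+2)%N).
Local Notation A := (O_Delta charK n_gt1).
Local Notation B := (pi_O_barDelta charK n_gt1).
Local Notation S := (swallowtail charK n_gt1).
Local Notation regA := (reg (Delta_aff charK n_gt1)).

Lemma restr_prim k : restr (prim K m k) = prim_lead K m k *: 'X^((m + k).+1).
Proof.
apply/polyP => i; rewrite coef_restr coef_antideriv mevalZ -coef_restr.
rewrite restrM restr_jac /restr map_polyXn mulrnAl -exprD coefMn coefXn.
rewrite coefZ coefXn.
case: i => [|i] /=; first by rewrite invr0 mul0r mulr0.
rewrite eqSS; case: eqP => [->|_]; last by rewrite mul0rn !mulr0.
by rewrite mulr1 mulrC.
Qed.

Lemma gens_swallow i : in_swallowtail (gens K i : {poly {mpoly K[m]}}).
Proof.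
rewrite /gens; case: ifP => _; last exact: swallow_prim.
by rewrite -polyC1; apply: swallowC.
Qed.

Lemma swallowtail_generators : (0 < m)%N ->
  exists g : 'I_m -> S, generates g.
Proof.
move=> m0.
have /choice [g Eg] i : exists s : S, swallow_poly s = gens K i.
  exact/swallow_poly_onto/gens_swallow.
exists g => s; have [c Ec] := swallow_spanned charK m0 (swallow_poly_swallow s).
exists (fun i => regA (c i)); apply: swallow_poly_inj; rewrite Ec.
rewrite swallow_poly_sum; apply: eq_bigr => i _.
by rewrite swallow_polyZ O_Delta_poly_reg Eg.
Qed.

Definition origin_value (a : A) : K := (restr (O_Delta_poly a))`_0.

(** The restriction of [gens] of index i is a constant times t^(gap_index i). *)
Definition gap_index (i : nat) : nat := if i == 0 then 0 else (m.+2 + i)%N.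

Lemma gap_indexP (i : 'I_m) :
  gap_index i = 0 \/ (m.+2 < gap_index i < m.+1.*2)%N.
Proof.
rewrite /gap_index; case: eqP => [_|i0]; [by left|right].
by have := ltn_ord i; lia.
Qed.

Lemma gap_index_inj : injective gap_index.
Proof. by move=> i j; rewrite /gap_index; do 2!case: eqP; lia. Qed.

Lemma swallowtail_lower_bound l (g : 'I_l -> S) : generates g -> (m <= l)%N.
Proof.
pose lam (s : S) : 'rV[K]_m := \row_i (restr (swallow_poly s))`_(gap_index i).
apply: (@generators_lower_bound _ _ _ m origin_value lam) => [s t|a s|i].
- by apply/rowP => i; rewrite !mxE swallow_polyD restrD coefD.
- apply/rowP => i; rewrite !mxE swallow_polyZ.
  rewrite /origin_value; have [q ->] := O_Delta_poly_form_subst a.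
  have [->|gap] := gap_indexP i; first by rewrite coef_form_substM_low.
  by rewrite coef_form_substM_swallow //; apply: swallow_poly_swallow.
pose e : {poly {mpoly K[m]}} := if i == 0 :> nat then 1 else
  ((prim_lead K m i.+1)^-1%:MP)%:P * prim K m i.+1.
have restr_e : restr e = 'X^(gap_index i).
  rewrite /e /gap_index; case: eqP => _.
    by rewrite (rmorph1 (@restr K m)).
  rewrite restrM restrC mevalC restr_prim mul_polyC scalerA.
  by rewrite mulVf ?prim_lead_neq0 // scale1r addnS !addSn.
have /(swallow_poly_onto charK n_gt1) [s Es] : in_swallowtail e.
  rewrite /e; case: ifP => _; first by rewrite -polyC1; apply: swallowC.
  by apply: swallowM; [apply: swallowC|apply: swallow_prim].
exists s; apply/rowP => j; rewrite !mxE Es restr_e coefXn eqxx /=.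
by rewrite (inj_eq gap_index_inj).
Qed.

Lemma normalization_lower_bound l (g : 'I_l -> B) : generates g -> (m < l)%N.
Proof.
pose lam (b : B) : 'rV[K]_m.+1 := \row_i (restr (barDelta_poly b))`_i.
apply: (@generators_lower_bound _ _ _ m.+1 origin_value lam) => [s t|a s|i].
- apply/rowP => i; rewrite !mxE (rmorphD (@barDelta_poly K charK m n_gt1)).
  by rewrite restrD coefD.
- apply/rowP => i; rewrite !mxE barDelta_poly_scale /origin_value.
  have [q ->] := O_Delta_poly_form_subst a.
  by rewrite coef_form_substM_low // -ltnS.
exists (barDelta_fun charK n_gt1 'X^i); apply/rowP => j.
by rewrite !mxE barDelta_funK /restr map_polyXn coefXn eqxx.
Qed.

Definition restr_act : A -> {poly K} :=
  @restr K m \o @O_Delta_poly K charK m n_gt1.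

HB.instance Definition _ := GRing.RMorphism.on restr_act.

Lemma swallowtail_restr_eq0 (s : S) : restr (swallow_poly s) = 0 ->
  exists (a : 'I_m -> A) (t : 'I_m -> S),
    (forall k, restr_act (a k) = 0) /\ s = \sum_k a k *: t k.
Proof.
move/(swallow_restr_eq0 charK (swallow_poly_swallow s)) => [e se Es].
have /choice [t Et] k : exists t : S, swallow_poly t = e k.
  exact: swallow_poly_onto.
have /choice [q Eq] (k : 'I_m) := form_subst_const ('X_k : {mpoly K[m]}).
exists (fun k => regA (q k)), t; split=> [k|].
  by rewrite /restr_act /= O_Delta_poly_reg Eq restrC mevalXU.
apply: swallow_poly_inj; rewrite swallow_poly_sum Es.
by apply: eq_bigr => k _; rewrite swallow_polyZ O_Delta_poly_reg Eq Et.
Qed.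

Section Free.
Import monalg.
Variables (I : choiceType) (f : {linear {malg A[I]} -> S}).
Hypothesis f_bij : bijective f.
Local Notation basis i := (f (mkmalgU i 1)).

(** The combination a e_i - b e_j restricts to 0, hence is a combination of
    elements of the swallowtail with coefficients that restrict to 0; comparing
    coordinates in the basis, so do a and b. *)
Lemma basis_restr_independent (i j : I) (a b : A) : i != j ->
    restr_act a * restr (swallow_poly (basis i)) =
    restr_act b * restr (swallow_poly (basis j)) ->
  restr_act a = 0 /\ restr_act b = 0.
Proof.
move=> neq_ij eq_ab; have [g fK gK] := f_bij.
pose u : {malg A[I]} := a *: mkmalgU i 1 - b *: mkmalgU j 1.
have /swallowtail_restr_eq0 [c [t [c0 Et]]] : restr (swallow_poly (f u)) = 0.
  have -> : f u = a *: basis i + (- b) *: basis j.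
    exact: linear_scaleB.
  rewrite swallow_polyD !swallow_polyZ restrD !restrM -/(restr_act a) eq_ab.
  have -> : restr (O_Delta_poly (- b)) = - restr_act b.
    exact: (rmorphN restr_act).
  by rewrite mulNr subrr.
have Eu : u = \sum_k c k *: g (t k).
  apply: (can_inj fK); rewrite linear_sumZ Et.
  by apply: eq_bigr => k _; rewrite gK.
by apply: (malg_pair_ideal (h := restr_act)) Eu c0.
Qed.

(** With N = (m+1) D, multiplying the restriction of each basis element by t^N
    times that of the other one gives a relation over the cuspidal ring.  Both
    restrictions must then be 0, so 1, 1 would be the coefficients of a relation
    too. *)
Lemma basis_unique (i j : I) : i = j.
Proof.
apply/eqP; apply: contraT => neq_ij.
set ri := restr (swallow_poly (basis i)).
set rj := restr (swallow_poly (basis j)).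
pose D := maxn (size ri) (size rj).
have [p Ep] := on_cusp_conductor charK m (leqW (leq_maxl _ _ : size ri <= D)%N).
have [q Eq] := on_cusp_conductor charK m (leqW (leq_maxr _ _ : size rj <= D)%N).
have [] := @basis_restr_independent i j (regA q) (regA p) neq_ij.
  by rewrite /restr_act /= !O_Delta_poly_reg Eq Ep -!mulrA [rj * _]mulrC.
have X0 (r : {poly K}) : 'X^(m.+1 * D) * r = 0 -> r = 0.
  move/eqP; rewrite mulf_eq0 (negPf (monic_neq0 (monicXn _ _))) /=.
  by move/eqP.
rewrite /restr_act /= !O_Delta_poly_reg Eq Ep => /X0 rj0 /X0 ri0.
have [] := @basis_restr_independent i j 1 1 neq_ij.
  by rewrite -/ri -/rj ri0 rj0.
by move/eqP; rewrite (rmorph1 restr_act) oner_eq0.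
Qed.

End Free.

Lemma swallowtail_not_free : (1 < m)%N -> ~ free_module S.
Proof.
move=> m1 [I [f f_bij]]; have [g gen] := malg_generated_by_one A (basis_unique f_bij).
have := swallowtail_lower_bound (generates_iso gen f_bij).
by rewrite leqNgt m1.
Qed.

End Main.

Theorem proposition3p3 (K : closedFieldType) (charK : [pchar K] =i pred0)
    (n : nat) (hn : (2 < n)%N) :
  minimally_generated_by (swallowtail charK (ltnW hn)) (n - 2) /\
  ~ module_iso (swallowtail charK (ltnW hn)) (pi_O_barDelta charK (ltnW hn)) /\
  ((3 < n)%N -> ~ free_module (swallowtail charK (ltnW hn))).
Proof.
case: n hn => [|[|m]] // hn; rewrite !subSS subn0.
have [g gen] := swallowtail_generators charK (ltnW hn) hn.
split; [split; [by exists g|exact: swallowtail_lower_bound]|split].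
  case=> f f_bij.
  by have := normalization_lower_bound (generates_iso gen f_bij); rewrite ltnn.
exact: swallowtail_not_free.
Qed.
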